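(* Let $r\geq 2$ be an integer, let $h:\mathbb{Z}_{\geq 1}\to\mathbb{C}$ satisfy $|h(d)|\ll d^\alpha$ for some $\alpha\in\left[0,\frac{1}{2r-1}\right]$, and define $f:\mathbb{Z}_{\geq1}\to\mathbb{C}$ by $f(n)=h(d)$ if $n=d^r$ for a positive integer $d$, and $f(n)=0$ otherwise. Suppose there exists an exponent pair $(k,\ell)$ such that $\ell = rk$. Then, for $x\geq 2$, \[ \sum_{n\leq x} f\left(\left\lfloor\frac{x}{n}\right\rfloor\right) = C_f x + O\left(x^{\frac{\alpha}{r+1}+\frac{k}{k+1}}\log x + x^{\frac{1+\alpha}{2r}}\right), \qquad C_f=\sum_{n=1}^\infty\frac{f(n)}{n(n+1)}, \] where the factor $\log x$ is present only when $\alpha=0$ (i.e. for $\alpha>0$ the error term is $O\big(x^{\frac{\alpha}{r+1}+\frac{k}{k+1}} + x^{\frac{1+\alpha}{2r}}\big)$).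
   Context: $\lfloor t\rfloor$ denotes the integer part of $t$; $e(t)=e^{2\pi i t}$. Implied constants may depend on $r$, $h$, and the exponent pair. Exponent pair (standard definition, as in Graham–Kolesnik): for $s>0$, $N\ge1$, $y>0$, an integer $P\ge1$ and $\varepsilon>0$, let $\mathcal{F}(N,P,s,y,\varepsilon)$ be the set of real functions $g$ on an interval $I\subseteq(N,2N]$ with $P$ continuous derivatives satisfying $|g^{(j+1)}(t)-(-1)^j (s)_j\, y\, t^{-s-j}|\le \varepsilon\,(s)_j\, y\, t^{-s-j}$ for $0\le j\le P-1$, $t\in I$, where $(s)_j=s(s+1)\cdots(s+j-1)$. A pair $(k,\ell)$ with $0\le k\le \tfrac12\le \ell\le 1$ is an exponent pair if for every $s>0$ there exist $P$ and $\varepsilon>0$ such that for all $N\ge1$, $y>0$, intervals $I\subseteq(N,2N]$ and $g\in\mathcal{F}(N,P,s,y,\varepsilon)$, \[ \sum_{n\in I} e(g(n)) \ll (yN^{-s})^k N^\ell + y^{-1}N^{s}, \] with implied constant depending only on $k,\ell,s$. *)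

(* Defs.v *)
From Stdlib Require Import Reals Lra Lia ZArith Classical ClassicalDescription.
From Coquelicot Require Import Coquelicot.
Open Scope R_scope.

Definition e_ (t : R) : C := (cos (2 * PI * t), sin (2 * PI * t)).

Fixpoint Csum_upto (F : nat -> C) (n : nat) : C :=
  match n with
  | O => F O
  | S m => Cplus (Csum_upto F m) (F (S m))
  end.
Definition Csum (lo hi : nat) (F : nat -> C) : C :=
  Csum_upto (fun n => if andb (lo <=? n)%nat (n <=? hi)%nat then F n else RtoC 0) hi.

(* classical indicator-restricted sum over the integers n in a set I of reals,
   for I contained in (0, B] *)
Definition sum_over_set (I : R -> Prop) (B : nat) (F : nat -> C) : C :=
  Csum 1 B (fun n => if excluded_middle_informative (I (INR n)) then F n else RtoC 0).

Fixpoint poch (s : R) (j : nat) : R :=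
  match j with
  | O => 1
  | S m => poch s m * (s + INR m)
  end.

Definition is_interval (I : R -> Prop) : Prop :=
  forall x y z, I x -> I z -> x <= y <= z -> I y.

Definition deriv_chain (I : R -> Prop) (G : nat -> R -> R) (P : nat) : Prop :=
  (forall j t, (j < P)%nat -> I t ->
     filterlim (fun u => (G j u - G j t) / (u - t))
               (within (fun u => I u /\ u <> t) (locally t)) (locally (G (S j) t)))
  /\ (forall t, I t -> filterlim (G P) (within I (locally t)) (locally (G P t))).

Definition in_F (N : R) (P : nat) (s y eps : R) (I : R -> Prop) (G : nat -> R -> R) : Prop :=
  deriv_chain I G P /\
  forall j t, (j < P)%nat -> I t ->
    Rabs (G (S j) t - (-1) ^ j * poch s j * y * Rpower t (- s - INR j))
      <= eps * poch s j * y * Rpower t (- s - INR j).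

Definition exponent_pair (k l : R) : Prop :=
  0 <= k <= 1/2 /\ 1/2 <= l <= 1 /\
  forall s, 0 < s ->
  exists (P : nat) (eps : R) (A : R), (1 <= P)%nat /\ 0 < eps /\
    forall (N y : R) (I : R -> Prop) (G : nat -> R -> R),
      1 <= N -> 0 < y -> is_interval I ->
      (forall t, I t -> N < t <= 2 * N) ->
      in_F N P s y eps I G ->
      Cmod (sum_over_set I (Z.to_nat (Int_part (2 * N))) (fun n => e_ (G O (INR n))))
        <= A * (Rpower (y * Rpower N (- s)) k * Rpower N l + / y * Rpower N s).

(* f(n) = h(d) if n = d^r with d >= 1, and 0 otherwise (d is unique) *)
Definition f_of (r : nat) (h : nat -> C) (n : nat) : C :=
  Csum 1 n (fun d => if Nat.eqb (d ^ r) n then h d else RtoC 0).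

Definition nfloor (x : R) : nat := Z.to_nat (Int_part x).

Definition S_sum (f : nat -> C) (x : R) : C :=
  Csum 1 (nfloor x) (fun n => f (nfloor (x / INR n))).

(* Main.v *)
(* Since f lives on r-th powers, the sum over n <= x with q = floor(x/n) splits by the size of q.
   For q up to about sqrt x each q = m occurs x/(m(m+1)) + O(1) times, which gives the main term with
   error sum_{m << sqrt x} |f m| << x^((1+alpha)/(2r)); the tail of C_f is of the same size.
   For larger q one only needs an upper bound for the number of solutions of floor(x/n) = d^r.
   With Z = x^(1/(r+1)), solutions with n <= Z force (x/n)^(1/r) to lie close to an integer, and
   solutions with n > Z have d <= Z and force x/d^r to lie close to an integer. Both are counted in
   dyadic blocks by the Fejer kernel and the exponent pair, applied in each case to a pure power
   X t^(-p), with p = 1/r or p = r. The relation l = r k makes the optimised bound for d of size D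
   equal to x^(k/(k+1)) for every D, and equal to x^(k/(k+1)) times a positive power of N/Z for n of
   size N <= Z. *)
Require Import Defs.
From Stdlib Require Import Reals ZArith Classical ClassicalDescription Lra Lia Psatz.
From Coquelicot Require Import Coquelicot.
(* Reals also exports an [nfloor]. *)
Import Defs.
Open Scope R_scope.

(** Beyond the cut-off only upper bounds are wanted, so nonnegativity of the Fejer kernel does all
    the work and only cosine sums occur. Their bound has to be uniform in the frequency m < H. The
    counting lemma keeps a free threshold T in place of the kernel length H, which is about N/T;
    balancing the terms is then the equation T = (N X N^(-p-1) / T)^k N^l, solved by T = x^(k/(k+1))
    for p = r and by T = x^(k/(k+1)) (N/Z)^c for p = 1/r. Block bounds are summed by telescoping:
    each is dominated by Phi(2N) - Phi(N) for an explicit Phi. On the side of d the block carries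
    the weight N^alpha, whose primitive is a logarithm exactly for alpha = 0; this is the only
    origin of the log factor. On the side of n the power of N/Z outweighs the factor (x/n)^(alpha/r)
    coming from f, so the blocks form a geometric series. The second error term also arises on the
    side of d, from the width x d^(-2r) within which x/d^r must be close to an integer. *)

(** * Indicators and finite real sums *)

Definition ind (P : Prop) : R := if excluded_middle_informative P then 1 else 0.

Lemma ind_true (P : Prop) : P -> ind P = 1.
Proof. intros H; unfold ind; destruct (excluded_middle_informative P); tauto. Qed.

Lemma ind_false (P : Prop) : ~ P -> ind P = 0.
Proof. intros H; unfold ind; destruct (excluded_middle_informative P); tauto. Qed.

Lemma ind_bounds (P : Prop) : 0 <= ind P <= 1.
Proof. unfold ind; destruct (excluded_middle_informative P); lra. Qed.

Lemma ind_le (P Q : Prop) : (P -> Q) -> ind P <= ind Q.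
Proof.
  intros H; unfold ind.
  destruct (excluded_middle_informative P), (excluded_middle_informative Q); try lra; tauto.
Qed.

Fixpoint rsum (F : nat -> R) (n : nat) : R :=
  match n with O => 0 | S m => rsum F m + F (S m) end.

Lemma rsum_le (F G : nat -> R) n :
  (forall i, (1 <= i <= n)%nat -> F i <= G i) -> rsum F n <= rsum G n.
Proof.
  induction n as [|n IH]; intros H; simpl; [lra|].
  assert (F (S n) <= G (S n)) by (apply H; lia).
  assert (rsum F n <= rsum G n) by (apply IH; intros; apply H; lia). lra.
Qed.

Lemma rsum_ext (F G : nat -> R) n :
  (forall i, (1 <= i <= n)%nat -> F i = G i) -> rsum F n = rsum G n.
Proof.
  intros H; apply Rle_antisym; apply rsum_le; intros i Hi; rewrite (H i Hi); lra.
Qed.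

Lemma rsum_plus (F G : nat -> R) n :
  rsum (fun i => F i + G i) n = rsum F n + rsum G n.
Proof. induction n as [|n IH]; simpl; [lra|rewrite IH; ring]. Qed.

Lemma rsum_scal (c : R) (F : nat -> R) n :
  rsum (fun i => c * F i) n = c * rsum F n.
Proof. induction n as [|n IH]; simpl; [lra|rewrite IH; ring]. Qed.

Lemma rsum_const (c : R) n : rsum (fun _ => c) n = INR n * c.
Proof. induction n as [|n IH]; [simpl; lra|]. simpl rsum. rewrite IH, S_INR. ring. Qed.

Lemma rsum_nonneg (F : nat -> R) n :
  (forall i, (1 <= i <= n)%nat -> 0 <= F i) -> 0 <= rsum F n.
Proof.
  intros H. replace 0 with (rsum (fun _ => 0) n) by (rewrite rsum_const; ring).
  now apply rsum_le.
Qed.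

Lemma rsum_swap (F : nat -> nat -> R) n m :
  rsum (fun i => rsum (fun j => F i j) m) n = rsum (fun j => rsum (fun i => F i j) n) m.
Proof.
  induction n as [|n IH]; simpl.
  - rewrite rsum_const; ring.
  - rewrite IH, <- rsum_plus. reflexivity.
Qed.

Lemma rsum_first (F : nat -> R) n : rsum F (S n) = F 1%nat + rsum (fun i => F (S i)) n.
Proof.
  induction n as [|n IH]; [simpl; ring|].
  change (rsum F (S (S n))) with (rsum F (S n) + F (S (S n))). rewrite IH. simpl. ring.
Qed.

Lemma rsum_rev (F : nat -> R) n : rsum F n = rsum (fun i => F (S n - i)%nat) n.
Proof.
  induction n as [|n IH]; [reflexivity|].
  rewrite (rsum_first (fun i => F (S (S n) - i)%nat)).
  simpl rsum at 1. rewrite IH. replace (S (S n) - 1)%nat with (S n) by lia.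
  rewrite Rplus_comm. reflexivity.
Qed.

(** Makes the summation bound immaterial for nonnegative terms of bounded support: the counts arise
    with cut-off [nfloor x], the exponent pair sums up to [nfloor (2 * N)]. *)
Lemma rsum_support (F : nat -> R) B0 B :
  (forall i, 0 <= F i) -> (forall i, (B0 < i)%nat -> F i = 0) -> rsum F B <= rsum F B0.
Proof.
  intros H0 H1. destruct (Nat.le_gt_cases B B0) as [H|H].
  - clear H1. induction H as [|m H IH]; simpl; [lra|]. specialize (H0 (S m)); lra.
  - apply Nat.lt_le_incl in H. induction H as [|m H IH]; simpl; [lra|].
    rewrite (H1 (S m)) by lia; lra.
Qed.

Lemma rsum_ind_eq_le (P : nat -> Prop) n :
  (forall i j, P i -> P j -> i = j) -> rsum (fun i => ind (P i)) n <= 1.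
Proof.
  intros H. induction n as [|n IH]; simpl; [lra|].
  destruct (classic (P (S n))) as [HP|HP].
  - rewrite (ind_true _ HP). rewrite (rsum_ext _ (fun _ => 0)).
    + rewrite rsum_const; lra.
    + intros i Hi. apply ind_false. intros Hc. specialize (H _ _ Hc HP). lia.
  - rewrite (ind_false _ HP); lra.
Qed.

(** * Counting near-integers with the Fejer kernel *)

(** Natural [q] are enough, since the integers met below are a root d or an index n, and they fit
    [cos_period], which is stated for natural multiples. *)
Definition near (d t : R) : Prop := exists q : nat, Rabs (t - INR q) <= d.

(** The squared modulus of S_H, the sum of exp(i j phi) over j = 1..H, is H times the Fejer kernel.
    Left as a sum of Dirichlet kernels it shows no weights 1 - m/H, and a bound for each single
    frequency is enough. *)
Lemma fejer_identity (phi : R) (H : nat) :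
  rsum (fun j => cos (INR j * phi)) H ^ 2 + rsum (fun j => sin (INR j * phi)) H ^ 2
  = rsum (fun i => 1 + 2 * rsum (fun m => cos (INR m * phi)) (i - 1)) H.
Proof.
  induction H as [|H IH]; [simpl; ring|].
  (* Read backwards, the cosine sum is the real part of exp(i (H+1) phi) times the conjugate of S_H,
     the cross term in the squared modulus of S_H + exp(i (H+1) phi). *)
  assert (Hrev : rsum (fun m => cos (INR m * phi)) H
    = cos (INR (S H) * phi) * rsum (fun j => cos (INR j * phi)) H
      + sin (INR (S H) * phi) * rsum (fun j => sin (INR j * phi)) H).
  { eapply eq_trans; [apply rsum_rev|].
    rewrite <- !rsum_scal, <- rsum_plus. apply rsum_ext; intros i Hi.
    rewrite minus_INR by lia.
    replace ((INR (S H) - INR i) * phi) with (INR (S H) * phi - INR i * phi) by ring.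
    rewrite cos_minus; reflexivity. }
  assert (E := sin2_cos2 (INR (S H) * phi)). unfold Rsqr in E.
  change (rsum ?F (S H)) with (rsum F H + F (S H)). cbv beta.
  replace (S H - 1)%nat with H by lia.
  rewrite <- IH. replace (1 + 2 * _) with (1 + 2 * (cos (INR (S H) * phi) * rsum (fun j => cos (INR j * phi)) H
      + sin (INR (S H) * phi) * rsum (fun j => sin (INR j * phi)) H))
    by (rewrite <- Hrev; reflexivity).
  clear - E. nra.
Qed.

(** Modulo 2 pi every angle is at most pi/4 in absolute value, hence below pi/3, so each cosine is
    at least 1/2. *)
Lemma cos_sum_lower (t : R) (H : nat) :
  (1 <= H)%nat -> near (1 / (8 * INR H)) t ->
  INR H / 2 <= rsum (fun j => cos (INR j * (2 * PI * t))) H.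
Proof.
  intros HH [q Hq].
  replace (INR H / 2) with (rsum (fun _ => 1 / 2) H) by (rewrite rsum_const; field).
  apply rsum_le; intros j Hj.
  assert (Hj' : INR j <= INR H) by (apply le_INR; lia).
  assert (HjO : 1 <= INR j) by (apply (le_INR 1); lia).
  set (u := t - INR q) in *.
  assert (E : INR j * (2 * PI * t) = INR j * (2 * PI * u) + 2 * INR (j * q) * PI).
  { rewrite mult_INR; unfold u; ring. }
  rewrite E, cos_period.
  assert (Hu : Rabs (INR j * u) <= 1 / 8).
  { rewrite Rabs_mult, (Rabs_pos_eq (INR j)) by lra.
    apply Rle_trans with (INR H * (1 / (8 * INR H))).
    - apply Rmult_le_compat; try lra. apply Rabs_pos.
    - right; field; lra. }
  assert (HP := PI_RGT_0).
  assert (Hv : Rabs (INR j * (2 * PI * u)) <= PI / 3).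
  { replace (INR j * (2 * PI * u)) with (2 * PI * (INR j * u)) by ring.
    rewrite Rabs_mult, (Rabs_pos_eq (2 * PI)) by lra. nra. }
  rewrite <- cos_PI3.
  assert (Ev : cos (INR j * (2 * PI * u)) = cos (Rabs (INR j * (2 * PI * u)))).
  { unfold Rabs; destruct (Rcase_abs _); [rewrite cos_neg|]; reflexivity. }
  rewrite Ev. apply cos_decr_1; try lra; try apply Rabs_pos.
Qed.

(** Near an integer the squared modulus is at least H^2/4, elsewhere it is nonnegative. Hence H^2/4
    times the weighted count is at most the full weighted sum, which is at most H (sum of a) + 2 H^2
    E. *)
Lemma fejer_count (a : nat -> R) (theta : nat -> R) (B H : nat) (E : R) :
  (forall n, 0 <= a n) -> (1 <= H)%nat -> 0 <= E ->
  (forall m, (1 <= m < H)%nat -> Rabs (rsum (fun n => a n * cos (INR m * (2 * PI * theta n))) B) <= E) ->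
  rsum (fun n => a n * ind (near (1 / (8 * INR H)) (theta n))) B <= 4 * rsum a B / INR H + 8 * E.
Proof.
  intros Ha HH HE Hm.
  assert (HO : 1 <= INR H) by (apply (le_INR 1); lia).
  set (cnt := rsum (fun n => a n * ind (near (1 / (8 * INR H)) (theta n))) B).
  assert (Hup : INR H ^ 2 / 4 * cnt <= INR H * (rsum a B + 2 * (INR H * E))).
  { apply Rle_trans with (rsum (fun n => a n *
      rsum (fun i => 1 + 2 * rsum (fun m => cos (INR m * (2 * PI * theta n))) (i - 1)) H) B).
    - unfold cnt. rewrite <- rsum_scal. apply rsum_le; intros n _.
      rewrite <- fejer_identity.
      set (c := rsum _ H). set (s := rsum _ H).
      destruct (classic (near (1 / (8 * INR H)) (theta n))) as [Hn|Hn].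
      + rewrite ind_true by exact Hn.
        assert (Hc := cos_sum_lower _ _ HH Hn). fold c in Hc.
        specialize (Ha n). assert (INR H ^ 2 / 4 <= c ^ 2 + s ^ 2) by nra. nra.
      + rewrite ind_false by exact Hn. specialize (Ha n).
        assert (0 <= c ^ 2 + s ^ 2) by nra. nra.
    - rewrite (rsum_ext _ (fun n => rsum (fun i => a n + 2 *
         rsum (fun m => a n * cos (INR m * (2 * PI * theta n))) (i - 1)) H)).
      2:{ intros n _. rewrite <- rsum_scal. apply rsum_ext; intros i _.
          rewrite rsum_scal. ring. }
      rewrite rsum_swap, <- rsum_const. apply rsum_le; intros i Hi.
      rewrite rsum_plus, rsum_scal. rewrite rsum_swap.
      apply Rplus_le_compat_l, Rmult_le_compat_l; [lra|].
      apply Rle_trans with (rsum (fun _ => E) (i - 1)).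
      + apply rsum_le; intros m Hm'. eapply Rle_trans; [apply Rle_abs|]. apply Hm; lia.
      + rewrite rsum_const. apply Rmult_le_compat_r; [exact HE|]. apply le_INR; lia. }
  apply Rmult_le_reg_l with (INR H ^ 2 / 4); [nra|].
  eapply Rle_trans; [exact Hup|]. right; field; lra.
Qed.

(** * Exponential sums with a pure power as phase *)

Lemma Rpower_pos (a b : R) : 0 < Rpower a b.
Proof. apply exp_pos. Qed.

Lemma filterlim_difference_quotient (I : R -> Prop) (f : R -> R) (t l : R) :
  derivable_pt_lim f t l ->
  filterlim (fun u => (f u - f t) / (u - t))
    (within (fun u => I u /\ u <> t) (locally t)) (locally l).
Proof.
  intros Hd. apply filterlim_locally; intros eps.
  destruct (Hd eps (cond_pos eps)) as [d Hd'].
  exists d; intros u Hu [_ Hne]. change (Rabs ((f u - f t) / (u - t) - l) < eps).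
  specialize (Hd' (u - t)). change R in u. replace (t + (u - t)) with u in Hd' by ring.
  apply Hd'; [lra|exact Hu].
Qed.

Lemma derivable_pt_lim_Rpower_scal (c a t : R) :
  0 < t -> derivable_pt_lim (fun u => c * Rpower u a) t (c * (a * Rpower t (a - 1))).
Proof.
  intros Ht.
  apply (derivable_pt_lim_scal (fun u => Rpower u a) c t). now apply derivable_pt_lim_power.
Qed.

(** The power is the model function itself: its deviation is zero, so every [eps] and [P] is
    admissible. The leading constant makes the first derivative y t^(-s), which for s > 1 forces the
    negative sign. *)
Lemma in_F_power (N s y eps : R) (P : nat) (I : R -> Prop) :
  1 < s -> 0 < y -> 0 < eps -> (forall t, I t -> 0 < t) ->
  in_F N P s y eps I (fun j => match j with
    | O => fun t => - (y / (s - 1)) * Rpower t (1 - s)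
    | S i => fun t => (-1) ^ i * poch s i * y * Rpower t (- s - INR i) end).
Proof.
  intros Hs Hy Heps HI.
  assert (Hd : forall j t, I t -> derivable_pt_lim ((fun j => match j with
    | O => fun t => - (y / (s - 1)) * Rpower t (1 - s)
    | S i => fun t => (-1) ^ i * poch s i * y * Rpower t (- s - INR i) end) j) t
      ((-1) ^ j * poch s j * y * Rpower t (- s - INR j))).
  { intros j t Ht. apply HI in Ht. destruct j as [|i].
    - replace ((-1) ^ 0 * poch s 0 * y * Rpower t (- s - INR 0))
        with (- (y / (s - 1)) * ((1 - s) * Rpower t (1 - s - 1))).
      + now apply derivable_pt_lim_Rpower_scal.
      + simpl. replace (1 - s - 1) with (- s - 0) by ring. field. lra.
    - replace ((-1) ^ S i * poch s (S i) * y * Rpower t (- s - INR (S i)))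
        with ((-1) ^ i * poch s i * y * ((- s - INR i) * Rpower t (- s - INR i - 1))).
      + now apply derivable_pt_lim_Rpower_scal.
      + rewrite S_INR. replace (- s - (INR i + 1)) with (- s - INR i - 1) by ring.
        simpl. ring. }
  assert (Hpoch : forall j, 0 < poch s j).
  { induction j as [|j IH]; simpl; [lra|]. assert (0 <= INR j) by apply pos_INR. nra. }
  split; [split|].
  - intros j t Hj Ht. apply filterlim_difference_quotient. exact (Hd j t Ht).
  - intros t Ht.
    eapply filterlim_filter_le_1; [apply (filter_le_within (F := locally t))|].
    apply continuity_pt_filterlim, derivable_continuous_pt. eexists; exact (Hd P t Ht).
  - intros j t _ Ht. rewrite Rminus_diag, Rabs_R0.
    assert (0 < Rpower t (- s - INR j)) by apply Rpower_pos.
    specialize (Hpoch j). repeat apply Rmult_le_pos; lra.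
Qed.

Lemma Csum_upto_Re (F : nat -> C) n :
  F O = RtoC 0 -> Re (Csum_upto F n) = rsum (fun i => Re (F i)) n.
Proof.
  intros H0. induction n as [|n IH]; simpl.
  - rewrite H0; reflexivity.
  - rewrite <- IH; reflexivity.
Qed.

Lemma Csum_Re (F : nat -> C) n : Re (Csum 1 n F) = rsum (fun i => Re (F i)) n.
Proof.
  unfold Csum. rewrite Csum_upto_Re by reflexivity. apply rsum_ext; intros i Hi.
  destruct (Nat.leb_spec 1 i), (Nat.leb_spec i n); try lia; reflexivity.
Qed.

Lemma INR_nfloor (x : R) : 0 <= x -> INR (nfloor x) <= x < INR (nfloor x) + 1.
Proof.
  intros Hx. unfold nfloor. destruct (base_Int_part x) as [H1 H2].
  assert (0 <= Int_part x)%Z.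
  { apply Z.lt_succ_r, lt_IZR. unfold Z.succ. rewrite plus_IZR. lra. }
  rewrite INR_IZR_INZ, Z2Nat.id by assumption. lra.
Qed.

Lemma le_nfloor (x : R) n : INR n <= x -> (n <= nfloor x)%nat.
Proof.
  intros H. assert (0 <= x) by (pose proof (pos_INR n); lra).
  destruct (INR_nfloor x) as [_ H2]; [lra|]. apply Nat.lt_succ_r, INR_lt. rewrite S_INR. lra.
Qed.

Lemma nfloor_lt (x : R) n : 0 <= x -> (nfloor x < n)%nat -> x < INR n.
Proof.
  intros Hx H. destruct (INR_nfloor x Hx) as [_ H2]. apply (le_INR (S _)) in H. rewrite S_INR in H. lra.
Qed.

Definition block (N : R) (n : nat) : R := ind (N < INR n <= 2 * N).

(** With s = p + 1 and y = p m X the phase is - m X t^(-p), and the cosine ignores the sign. For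
    uniformity in m the first term, increasing in m, is taken at m = H, and the second, decreasing,
    at m = 1. *)
Lemma power_phase_sum (k l p : R) :
  exponent_pair k l -> 0 < p ->
  exists A, 0 < A /\ forall (N X : R) (H m : nat), 1 <= N -> 0 < X -> (1 <= m <= H)%nat ->
    Rabs (rsum (fun n => block N n * cos (INR m * (2 * PI * (X * Rpower (INR n) (- p))))) (nfloor (2 * N)))
    <= A * (Rpower (INR H * X * Rpower N (- p - 1)) k * Rpower N l + Rpower N (p + 1) / X).
Proof.
  intros [Hk [Hl HE]] Hp.
  destruct (HE (p + 1)) as (P & eps & A & HP & Heps & HA); [lra|].
  (* [Rabs A + 1] because the constant in [exponent_pair] carries no sign condition. *)
  exists ((Rabs A + 1) * (Rpower p k + / p)).
  assert (HA0 := Rabs_pos A). assert (HA1 := Rle_abs A).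
  assert (Hpk := Rpower_pos p k). assert (Hp' := Rinv_0_lt_compat _ Hp).
  split; [nra|]. intros N X H m HN HX Hm.
  assert (Hm0 : 1 <= INR m) by (apply (le_INR 1); lia).
  assert (HmH : INR m <= INR H) by (apply le_INR; lia).
  set (y := p * INR m * X).
  assert (Hpm : 0 < p * INR m) by nra.
  assert (Hy : 0 < y) by (unfold y; nra).
  set (I := fun t => N < t <= 2 * N).
  assert (HF := in_F_power N (p + 1) y eps P I ltac:(lra) Hy Heps ltac:(unfold I; intros; lra)).
  apply HA in HF; try assumption; [|intros a b c; unfold I; intros; lra|intros t Ht; exact Ht].
  set (S := sum_over_set _ _ _) in HF.
  assert (HRe : Re S = rsum (fun n => block N n * cos (INR m * (2 * PI * (X * Rpower (INR n) (- p))))) (nfloor (2 * N))).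
  { unfold S, sum_over_set. rewrite Csum_Re. apply rsum_ext; intros n _.
    unfold block, ind. fold (I (INR n)). destruct (excluded_middle_informative (I (INR n))).
    - unfold e_. simpl Re. rewrite Rmult_1_l, <- cos_neg. f_equal.
      replace (1 - (p + 1)) with (- p) by ring. unfold y. field. lra.
    - simpl. ring. }
  rewrite <- HRe. eapply Rle_trans; [eapply Rle_trans; [|apply Rmax_Cmod]; apply Rmax_l|].
  eapply Rle_trans; [exact HF|].
  replace (- (p + 1)) with (- p - 1) by ring.
  assert (HNp := Rpower_pos N (- p - 1)). assert (HNl := Rpower_pos N l).
  assert (HNs := Rpower_pos N (p + 1)).
  assert (H1 : Rpower (y * Rpower N (- p - 1)) k <= Rpower p k * Rpower (INR H * X * Rpower N (- p - 1)) k).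
  { rewrite Rpower_mult_distr; [|lra|]. 2:{ apply Rmult_lt_0_compat; nra. }
    apply Rle_Rpower_l; [lra|]. split; [nra|].
    unfold y. replace (p * (INR H * X * Rpower N (- p - 1))) with ((p * X * Rpower N (- p - 1)) * INR H) by ring.
    replace (p * INR m * X * Rpower N (- p - 1)) with ((p * X * Rpower N (- p - 1)) * INR m) by ring.
    apply Rmult_le_compat_l; [|lra]. repeat apply Rmult_le_pos; lra. }
  assert (H2 : / y * Rpower N (p + 1) <= / p * (Rpower N (p + 1) / X)).
  { unfold y. rewrite !Rinv_mult. unfold Rdiv.
    assert (/ INR m <= 1) by (rewrite <- Rinv_1; apply Rinv_le_contravar; lra).
    assert (HX' := Rinv_0_lt_compat _ HX).
    replace (/ p * / INR m * / X * Rpower N (p + 1)) with ((/ p * / X * Rpower N (p + 1)) * / INR m) by ring.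
    replace (/ p * (Rpower N (p + 1) * / X)) with ((/ p * / X * Rpower N (p + 1)) * 1) by ring.
    apply Rmult_le_compat_l; [|lra]. repeat apply Rmult_le_pos; lra. }
  set (U := Rpower (INR H * X * Rpower N (- p - 1)) k) in *.
  assert (HU : 0 < U) by apply Rpower_pos.
  assert (HV : 0 < Rpower N (p + 1) / X) by (apply Rdiv_lt_0_compat; lra).
  set (V := Rpower N (p + 1) / X) in *.
  assert (HW : 0 < Rpower (y * Rpower N (- p - 1)) k) by apply Rpower_pos.
  assert (H3 : 0 < / y * Rpower N (p + 1)).
  { apply Rmult_lt_0_compat; [now apply Rinv_0_lt_compat|lra]. }
  apply Rle_trans with ((Rabs A + 1) * (Rpower p k * U * Rpower N l + / p * V)).
  - set (Q := _ * Rpower N l + / y * _).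
    assert (HQ : 0 < Q) by (apply Rplus_lt_0_compat; [now apply Rmult_lt_0_compat|exact H3]).
    apply Rle_trans with ((Rabs A + 1) * Q); [apply Rmult_le_compat_r; lra|].
    apply Rmult_le_compat_l; [lra|]. unfold Q. nra.
  - rewrite (Rmult_assoc (Rabs A + 1)). apply Rmult_le_compat_l; [lra|].
    assert (0 <= U * Rpower N l) by nra. nra.
Qed.

(** * Near-integer values of a power on one dyadic block *)

Lemma block_count (N : R) B : 1 <= N -> rsum (block N) B <= 2 * N.
Proof.
  intros HN. apply Rle_trans with (rsum (block N) (nfloor (2 * N))).
  - apply rsum_support; intros i; [apply ind_bounds|].
    intros Hi. apply nfloor_lt in Hi; [|lra]. apply ind_false. lra.
  - destruct (INR_nfloor (2 * N)) as [H _]; [lra|].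
    eapply Rle_trans; [|exact H]. rewrite <- (Rmult_1_r (INR _)), <- rsum_const.
    apply rsum_le; intros; apply ind_bounds.
Qed.

Lemma near_le (d d' t : R) : d <= d' -> near d t -> near d' t.
Proof. intros H [q Hq]; exists q; lra. Qed.

(** Taking H about N/T makes the diagonal term N/H of size T, and T stays free for balancing against
    the exponential sum. The width d caps H at 1/(8d), which costs N d. *)
Lemma near_count (k l p : R) :
  exponent_pair k l -> 0 < p ->
  exists A, 0 < A /\ forall (N X T d : R) (B : nat), 1 <= N -> 0 < X -> 0 < T -> 0 < d ->
    rsum (fun n => block N n * ind (near d (X * Rpower (INR n) (- p)))) B
    <= A * (N * d + T + Rpower (N / T * X * Rpower N (- p - 1)) k * Rpower N l
            + Rpower N (p + 1) / X).
Proof.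
  intros Hkl Hp. destruct (power_phase_sum k l p Hkl Hp) as (A & HA & HS).
  (* 128 comes from 8 N/H <= 16 (T + 8 N d), and 8 A from the term 8 E of [fejer_count]. *)
  exists (128 + 8 * A). split; [lra|]. intros N X T d B HN HX HT Hd.
  set (U := Rpower (N / T * X * Rpower N (- p - 1)) k * Rpower N l).
  assert (HU : 0 < U) by (apply Rmult_lt_0_compat; apply Rpower_pos).
  set (V := Rpower N (p + 1) / X).
  assert (HV : 0 < V) by (apply Rdiv_lt_0_compat; [apply Rpower_pos|lra]).
  assert (HNd : 0 < N * d) by nra.
  set (cnt := rsum _ B).
  assert (Htriv : cnt <= 2 * N).
  { eapply Rle_trans; [|apply (block_count N B HN)]. apply rsum_le; intros n _.
    assert (H1 := ind_bounds (near d (X * Rpower (INR n) (- p)))).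
    assert (H2 : 0 <= block N n <= 1) by apply ind_bounds. nra. }
  (* If N <= T or d >= 1/8 the trivial bound 2N suffices; otherwise both arguments of the minimum
     [v] are at least 1, so H >= 1. *)
  destruct (Rle_lt_dec N T) as [HNT|HNT]; [nra|].
  destruct (Rle_lt_dec (1 / 8) d) as [Hd8|Hd8]; [nra|].
  set (v := Rmin (N / T) (1 / (8 * d))).
  assert (Hv1 : 1 <= v).
  { apply Rmin_glb.
    - apply Rmult_le_reg_r with T; [lra|]. unfold Rdiv. rewrite Rmult_assoc, Rinv_l; lra.
    - apply Rmult_le_reg_r with (8 * d); [lra|]. unfold Rdiv. rewrite Rmult_assoc, Rinv_l; lra. }
  destruct (INR_nfloor v) as [HH1 HH2]; [lra|]. set (H := nfloor v) in *.
  assert (H1 : (1 <= H)%nat) by (apply le_nfloor; simpl; lra).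
  assert (H1' : 1 <= INR H) by (apply (le_INR 1); lia).
  assert (HdH : d <= 1 / (8 * INR H)).
  { assert (v * (8 * d) <= 1).
    { apply Rle_trans with (1 / (8 * d) * (8 * d)); [|right; field; lra].
      apply Rmult_le_compat_r; [lra|apply Rmin_r]. }
    apply Rmult_le_reg_r with (8 * INR H); [lra|].
    replace (1 / (8 * INR H) * (8 * INR H)) with 1 by (field; lra). nra. }
  (* [v] equals N/T or 1/(8d), so N <= v (T + 8 N d), and v < H + 1 <= 2 H. *)
  assert (HNH : N / INR H <= 2 * (T + 8 * (N * d))).
  { assert (Hv : N <= v * (T + 8 * (N * d))).
    { unfold v, Rmin. destruct (Rle_dec _ _).
      - apply Rle_trans with (N / T * T); [right; field; lra|].
        apply Rmult_le_compat_l; [|lra]. apply Rlt_le, Rdiv_lt_0_compat; lra.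
      - apply Rle_trans with (1 / (8 * d) * (8 * (N * d))); [right; field; lra|].
        apply Rmult_le_compat_l; [|lra]. apply Rlt_le, Rdiv_lt_0_compat; lra. }
    apply Rmult_le_reg_r with (INR H); [lra|].
    replace (N / INR H * INR H) with N by (field; lra). nra. }
  set (E := A * (U + V)).
  assert (HE : 0 < E) by (unfold E; nra).
  assert (Hc : cnt <= rsum (fun n => block N n * ind (near (1 / (8 * INR H)) (X * Rpower (INR n) (- p)))) (nfloor (2 * N))).
  { eapply Rle_trans; [|apply rsum_support].
    - apply rsum_le; intros n _. apply Rmult_le_compat_l; [apply ind_bounds|].
      apply ind_le. now apply near_le.
    - intros n. apply Rmult_le_pos; apply ind_bounds.
    - intros n Hn. apply nfloor_lt in Hn; [|lra].
      unfold block. rewrite ind_false by lra. ring. }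
  assert (HF := fejer_count (block N) (fun n => X * Rpower (INR n) (- p)) (nfloor (2 * N)) H E).
  cbv beta in HF. specialize (HF ltac:(intros; apply ind_bounds) H1 ltac:(lra)).
  assert (HM := block_count N (nfloor (2 * N)) HN).
  eapply Rle_trans; [exact Hc|]. eapply Rle_trans; [apply HF|].
  - intros m Hm. eapply Rle_trans; [apply (HS N X H m); try assumption; lia|].
    unfold E, U, V. apply Rmult_le_compat_l; [lra|]. apply Rplus_le_compat_r.
    apply Rmult_le_compat_r; [apply Rlt_le, Rpower_pos|].
    assert (HP := Rpower_pos N (- p - 1)).
    destruct Hkl as [[Hk _] _]. apply Rle_Rpower_l; [lra|]. split.
    + repeat apply Rmult_lt_0_compat; lra.
    + apply Rmult_le_compat_r; [lra|]. apply Rmult_le_compat_r; [lra|].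
      apply Rle_trans with v; [lra|apply Rmin_l].
  - assert (4 * rsum (block N) (nfloor (2 * N)) / INR H <= 8 * (N / INR H)).
    { unfold Rdiv. assert (0 < / INR H) by (apply Rinv_0_lt_compat; lra). nra. }
    unfold E in *. nra.
Qed.

(** * Telescoping over dyadic blocks *)

(** Blocks are peeled off from the top, (Z/2, Z], (Z/4, Z/2] and so on, and their bounds telescope.
    The last block may reach below Y, which is why the block bound is required from Y/2 on. *)
Lemma dyadic_sum (w : nat -> R) (Phi : R -> R) (Y : R) (B : nat) :
  0 < Y -> (forall N, Y / 2 <= N -> 0 <= Phi N) -> (forall n, 0 <= w n) ->
  forall Z, Y / 2 <= Z ->
  (forall N, Y / 2 <= N -> 2 * N <= Z ->
     rsum (fun n => block N n * w n) B <= Phi (2 * N) - Phi N) ->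
  rsum (fun n => ind (Y < INR n <= Z) * w n) B <= Phi Z.
Proof.
  intros HY HPhi Hw.
  (* Induction on a number of halvings that brings Z down to Y. *)
  assert (Hi : forall i : nat, forall Z, Z <= Y * 2 ^ i -> Y / 2 <= Z ->
    (forall N, Y / 2 <= N -> 2 * N <= Z ->
      rsum (fun n => block N n * w n) B <= Phi (2 * N) - Phi N) ->
    rsum (fun n => ind (Y < INR n <= Z) * w n) B <= Phi Z).
  { induction i as [|i IH]; intros Z HZ HZ' Hb.
    - rewrite (rsum_ext _ (fun _ => 0)).
      + rewrite rsum_const, Rmult_0_r. now apply HPhi.
      + intros n _. simpl in HZ. rewrite ind_false; lra.
    - destruct (Rle_lt_dec Z Y) as [HZY|HZY].
      { rewrite (rsum_ext _ (fun _ => 0)).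
        + rewrite rsum_const, Rmult_0_r. now apply HPhi.
        + intros n _. rewrite ind_false; lra. }
      assert (HI : rsum (fun n => ind (Y < INR n <= Z / 2) * w n) B <= Phi (Z / 2)).
      { apply IH; try lra. simpl in HZ; lra. intros; apply Hb; lra. }
      specialize (Hb (Z / 2) ltac:(lra) ltac:(lra)). replace (2 * (Z / 2)) with Z in Hb by field.
      apply Rle_trans with (rsum (fun n => ind (Y < INR n <= Z / 2) * w n + block (Z / 2) n * w n) B).
      + apply rsum_le; intros n _. rewrite <- Rmult_plus_distr_r.
        apply Rmult_le_compat_r; [apply Hw|]. unfold block.
        assert (H1 := ind_bounds (Y < INR n <= Z / 2)).
        assert (H2 := ind_bounds (Z / 2 < INR n <= 2 * (Z / 2))).
        destruct (classic (Y < INR n <= Z)) as [Hc|Hc]; [|rewrite (ind_false _ Hc); lra].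
        rewrite (ind_true _ Hc). destruct (Rle_lt_dec (INR n) (Z / 2)).
        * rewrite (ind_true (Y < INR n <= Z / 2)); lra.
        * rewrite (ind_true (Z / 2 < INR n <= 2 * (Z / 2))); lra.
      + rewrite rsum_plus. lra. }
  intros Z HZ. destruct (Pow_x_infinity 2) with (b := Z / Y) as [i Hi2].
  { rewrite Rabs_pos_eq; lra. }
  apply (Hi i); [|exact HZ]. specialize (Hi2 i (Nat.le_refl i)).
  rewrite Rabs_pos_eq in Hi2 by (apply pow_le; lra).
  apply Rle_trans with (Y * (Z / Y)); [right; field; lra|]. apply Rmult_le_compat_l; lra.
Qed.

Lemma exp_le_compat (a b : R) : a <= b -> exp a <= exp b.
Proof. intros [H| ->]; [left; now apply exp_increasing|lra]. Qed.

Lemma Rpower_exp (a b : R) : Rpower (exp a) b = exp (b * a).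
Proof. unfold Rpower. now rewrite ln_exp. Qed.

Lemma Rpower_ge_1 (x a : R) : 1 <= x -> 0 <= a -> 1 <= Rpower x a.
Proof. intros Hx Ha. rewrite <- (Rpower_O x) by lra. now apply Rle_Rpower. Qed.

Lemma Rpower_antitone (x y a : R) : 0 < x <= y -> a <= 0 -> Rpower y a <= Rpower x a.
Proof.
  intros [Hx Hxy] Ha. unfold Rpower. apply exp_le_compat.
  assert (ln x <= ln y) by (now apply ln_le). nra.
Qed.

(** Merges products, quotients and powers of exponentials into a single exponential, so that
    comparing powers of x and N becomes comparing exponents. *)
Ltac to_exp := unfold Rdiv;
  repeat first [rewrite Rpower_exp | rewrite <- exp_plus | rewrite <- exp_Ropp].

(** Solves F(2N) - F(N) = N^a, the form consumed by [dyadic_sum]. The case a = 0 produces the factor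
    ln x of the theorem. *)
Definition dyadic_primitive (a N : R) : R :=
  if Req_EM_T a 0 then ln N / ln 2 else Rpower N a / (Rpower 2 a - 1).

Lemma Rpower_2_gt_1 (a : R) : 0 < a -> 1 < Rpower 2 a.
Proof. intros Ha. rewrite <- (Rpower_O 2) by lra. apply Rpower_lt; lra. Qed.

Lemma ln_2_bounds : 1 / 2 < ln 2 < 1.
Proof.
  assert (H := ln_lt_2). split; [lra|]. clear H.
  rewrite <- (ln_exp 1). apply ln_increasing; [lra|]. assert (H := exp_ineq1 1). lra.
Qed.

Lemma dyadic_primitive_step (a N : R) : 0 <= a -> 0 < N ->
  dyadic_primitive a (2 * N) - dyadic_primitive a N = Rpower N a.
Proof.
  intros Ha HN. assert (H2 := ln_2_bounds). unfold dyadic_primitive. destruct (Req_EM_T a 0) as [->|Hne].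
  - rewrite ln_mult, Rpower_O by lra. field. lra.
  - assert (H := Rpower_2_gt_1 a ltac:(lra)).
    rewrite <- Rpower_mult_distr by lra. field. lra.
Qed.

Lemma dyadic_primitive_nonneg (a N : R) : 0 <= a -> 1 <= N -> 0 <= dyadic_primitive a N.
Proof.
  intros Ha HN. assert (H2 := ln_2_bounds). unfold dyadic_primitive. destruct (Req_EM_T a 0) as [->|Hne].
  - apply Rdiv_le_0_compat; [|lra]. rewrite <- ln_1. apply ln_le; lra.
  - assert (H := Rpower_2_gt_1 a ltac:(lra)).
    apply Rdiv_le_0_compat; [|lra]. apply Rlt_le, Rpower_pos.
Qed.

Definition main_error (r : nat) (alpha k x : R) : R :=
  Rpower x (alpha / (INR r + 1) + k / (k + 1)) * (if Req_EM_T alpha 0 then ln x else 1).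

(** Absorbs bounds free of logarithms; the factor 2 covers alpha = 0, where ln x >= ln 2 > 1/2. *)
Lemma main_error_ge (r : nat) (alpha k x : R) : 2 <= x ->
  Rpower x (alpha / (INR r + 1) + k / (k + 1)) <= 2 * main_error r alpha k x.
Proof.
  intros Hx. unfold main_error. assert (H := Rpower_pos x (alpha / (INR r + 1) + k / (k + 1))).
  destruct (Req_EM_T alpha 0); [|lra].
  assert (H2 := ln_2_bounds). assert (ln 2 <= ln x) by (apply ln_le; lra). nra.
Qed.

(** * The two dyadic ranges for large quotients *)

Section Ranges.
Variables (r : nat) (alpha k l : R).
Hypothesis Hr : (2 <= r)%nat.
Hypothesis Halpha : 0 <= alpha <= 1 / 3.
Hypothesis Hkl : exponent_pair k l.
Hypothesis Hlk : l = INR r * k.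

Lemma r_ge_2 : 2 <= INR r.
Proof. now apply (le_INR 2). Qed.

Lemma k_pos : 0 < k.
Proof. destruct Hkl as (H1 & H2 & _). assert (H := r_ge_2). nra. Qed.

(** If floor(x/n) = m = d^r then n lies in (x/(m+1), x/m], of length at most x/m^2 = x d^(-2r),
    whence the width. The lower limit for d is twice x^(1/(2r)) so that every block has N >=
    x^(1/(2r)). *)
Lemma large_quotient_range :
  exists K, 0 < K /\ forall (x : R) (B : nat), 2 <= x ->
  rsum (fun d => ind (2 * Rpower x (1 / (2 * INR r)) < INR d <= Rpower x (1 / (INR r + 1)))
    * (Rpower (INR d) alpha
       * ind (near (x * Rpower (INR d) (- (2 * INR r))) (x * Rpower (INR d) (- INR r))))) B
  <= K * (main_error r alpha k x + Rpower x ((1 + alpha) / (2 * INR r))).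
Proof.
  assert (Hr2 := r_ge_2). assert (Hk := k_pos).
  destruct (near_count k l (INR r) Hkl ltac:(lra)) as (A & HA & HN).
  set (c2 := Rpower 2 alpha). assert (Hc2 : 0 < c2) by apply Rpower_pos.
  set (g := if Req_EM_T alpha 0 then 1 / ln 2 else 1 / (c2 - 1)).
  assert (Hg : 0 < g).
  { assert (H2 := ln_2_bounds). unfold g. destruct (Req_EM_T alpha 0).
    - apply Rdiv_lt_0_compat; lra.
    - assert (H := Rpower_2_gt_1 alpha ltac:(lra)). fold c2 in H. apply Rdiv_lt_0_compat; lra. }
  exists (A * c2 * (3 * g + 2)). assert (HAc : 0 < A * c2) by (apply Rmult_lt_0_compat; lra).
  split; [apply Rmult_lt_0_compat; lra|].
  intros x B Hx.
  set (y0 := Rpower x (1 / (2 * INR r))). set (Z := Rpower x (1 / (INR r + 1))).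
  set (T := Rpower x (k / (k + 1))).
  (* The first part is the primitive of 3 T N^alpha: T twice, and once more for N^(r+1)/x <= T. The
     second is the primitive of y0^(1+alpha) y0/N, normalised to be nonnegative for N >= y0. *)
  set (Phi := fun N => A * c2 * (3 * T * dyadic_primitive alpha N
                 + 2 * Rpower y0 (1 + alpha) * (1 - y0 / N))).
  assert (Hx1 : 1 <= x) by lra.
  assert (Hy1 : 1 <= y0).
  { apply Rpower_ge_1; [lra|]. apply Rdiv_le_0_compat; lra. }
  assert (HT1 : 1 <= T).
  { apply Rpower_ge_1; [lra|]. apply Rdiv_le_0_compat; lra. }
  assert (HyZ : y0 <= Z).
  { apply Rle_Rpower; [lra|]. apply Rmult_le_compat_l; [lra|]. apply Rinv_le_contravar; lra. }
  assert (HyP := Rpower_pos y0 (1 + alpha)).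
  assert (Hmain : rsum (fun d => ind (2 * y0 < INR d <= Z) * (Rpower (INR d) alpha
       * ind (near (x * Rpower (INR d) (- (2 * INR r))) (x * Rpower (INR d) (- INR r))))) B <= Phi Z).
  { apply dyadic_sum; try lra.
    - intros N HNy. assert (HNy' : y0 <= N) by lra. unfold Phi.
      assert (H0 := dyadic_primitive_nonneg alpha N ltac:(lra) ltac:(lra)).
      assert (y0 / N <= 1).
      { apply Rmult_le_reg_r with N; [lra|]. unfold Rdiv. rewrite Rmult_assoc, Rinv_l; lra. }
      apply Rmult_le_pos; [nra|]. apply Rplus_le_le_0_compat; nra.
    - intros n. apply Rmult_le_pos; [apply Rlt_le, Rpower_pos|apply ind_bounds].
    - intros N HNy HNZ. assert (HNy' : y0 <= N) by lra. clear HNy.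
      assert (HN0 : 0 < N) by lra.
      set (d := x * Rpower N (- (2 * INR r))).
      assert (Hd : 0 < d) by (apply Rmult_lt_0_compat; [lra|apply Rpower_pos]).
      apply Rle_trans with (c2 * Rpower N alpha *
        rsum (fun n => block N n * ind (near d (x * Rpower (INR n) (- INR r)))) B).
      { rewrite <- rsum_scal. apply rsum_le; intros n _. unfold block.
        destruct (classic (N < INR n <= 2 * N)) as [Hn|Hn].
        2:{ rewrite (ind_false _ Hn). lra. }
        rewrite (ind_true _ Hn), !Rmult_1_l. apply Rmult_le_compat.
        - apply Rlt_le, Rpower_pos.
        - apply ind_bounds.
        - unfold c2. rewrite Rpower_mult_distr by lra. apply Rle_Rpower_l; lra.
        - apply ind_le, near_le. unfold d. apply Rmult_le_compat_l; [lra|].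
          apply Rpower_antitone; lra. }
      specialize (HN N x T d B ltac:(lra) ltac:(lra) ltac:(lra) Hd).
      assert (HNa := Rpower_pos N alpha).
      eapply Rle_trans; [apply Rmult_le_compat_l; [apply Rmult_le_pos; lra|exact HN]|].
      unfold Phi.
      assert (Hstep := dyadic_primitive_step alpha N ltac:(lra) HN0).
      replace (dyadic_primitive alpha (2 * N)) with (dyadic_primitive alpha N + Rpower N alpha) by lra.
      set (L := ln x). assert (Ex : x = exp L) by (unfold L; rewrite exp_ln; lra).
      set (u := ln N). assert (EN : N = exp u) by (unfold u; rewrite exp_ln; lra).
      assert (Huv : L / (2 * INR r) <= u).
      { replace (L / (2 * INR r)) with (ln y0); [apply ln_le; lra|].
        unfold y0. rewrite Ex, Rpower_exp, ln_exp. field; lra. }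
      assert (HuZ : u <= L / (INR r + 1)).
      { replace (L / (INR r + 1)) with (ln Z); [apply ln_le; lra|].
        unfold Z. rewrite Ex, Rpower_exp, ln_exp. field; lra. }
      (* N^(-r k) N^l = 1, which leaves (x/T)^k = T. *)
      assert (H3 : Rpower (N / T * x * Rpower N (- INR r - 1)) k * Rpower N l = T).
      { unfold T. rewrite Ex, EN, Hlk. to_exp. f_equal. field. lra. }
      assert (H4 : Rpower N (INR r + 1) / x <= T).
      { apply Rle_trans with 1; [|lra]. rewrite <- exp_0 at 2. rewrite Ex, EN. to_exp. apply exp_le_compat.
        assert ((INR r + 1) * u <= L); [|lra].
        replace L with ((INR r + 1) * (L / (INR r + 1))) by (field; lra).
        apply Rmult_le_compat_l; lra. }
      (* As x = y0^(2r), the left side is y0^(1+alpha) (N/y0)^(1+alpha-2r), and this exponent is at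
         most -1. *)
      assert (H1 : Rpower N alpha * (N * d) <= Rpower y0 (1 + alpha) * (y0 / N)).
      { unfold d, y0. rewrite Ex, EN. to_exp. apply exp_le_compat.
        set (v := L / (2 * INR r)) in *.
        assert (EL : L = 2 * INR r * v) by (unfold v; field; lra). rewrite EL.
        replace (1 * / (2 * INR r) * (2 * INR r * v)) with v by (field; lra). nra. }
      rewrite H3.
      replace (A * c2 * (3 * T * (dyadic_primitive alpha N + Rpower N alpha) + 2 * Rpower y0 (1 + alpha) * (1 - y0 / (2 * N)))
         - A * c2 * (3 * T * dyadic_primitive alpha N + 2 * Rpower y0 (1 + alpha) * (1 - y0 / N)))
        with (A * c2 * (3 * T * Rpower N alpha + Rpower y0 (1 + alpha) * (y0 / N))) by (field; lra).
      replace (c2 * Rpower N alpha * (A * (N * d + T + T + Rpower N (INR r + 1) / x)))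
        with (A * c2 * (Rpower N alpha * (N * d) + Rpower N alpha * (T + T + Rpower N (INR r + 1) / x))) by ring.
      apply Rmult_le_compat_l; [lra|]. nra. }
  eapply Rle_trans; [exact Hmain|]. unfold Phi.
  rewrite (Rmult_assoc (A * c2)). apply Rmult_le_compat_l; [lra|].
  assert (E2 : Rpower y0 (1 + alpha) = Rpower x ((1 + alpha) / (2 * INR r))).
  { unfold y0. rewrite Rpower_mult. f_equal. field; lra. }
  rewrite <- E2.
  (* For alpha > 0, Z^alpha = x^(alpha/(r+1)); for alpha = 0, ln Z <= ln x. The denominators sit in
     [g]. *)
  assert (E1 : T * dyadic_primitive alpha Z <= g * main_error r alpha k x).
  { unfold dyadic_primitive, main_error, g, T, Z.
    rewrite Rpower_plus. assert (H := Rpower_pos x (k / (k + 1))).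
    assert (H2 := ln_2_bounds).
    destruct (Req_EM_T alpha 0) as [E|Hne].
    - rewrite E. replace (0 / (INR r + 1)) with 0 by (field; lra). rewrite Rpower_O by lra.
      assert (Hln : ln (Rpower x (1 / (INR r + 1))) <= ln x).
      { apply ln_le; [apply Rpower_pos|]. rewrite <- (Rpower_1 x) at 2 by lra.
        apply Rle_Rpower; [lra|]. apply Rmult_le_reg_r with (INR r + 1); [lra|].
        unfold Rdiv. rewrite Rmult_assoc, Rinv_l; lra. }
      set (T0 := Rpower x (k / (k + 1))) in *.
      replace (1 / ln 2 * (1 * T0 * ln x)) with (T0 * (ln x / ln 2)) by (field; lra).
      apply Rmult_le_compat_l; [lra|].
      apply Rmult_le_compat_r; [apply Rlt_le, Rinv_0_lt_compat; lra|exact Hln].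
    - rewrite Rpower_mult. replace (1 / (INR r + 1) * alpha) with (alpha / (INR r + 1)) by (field; lra).
      right. fold c2. assert (Hc := Rpower_2_gt_1 alpha ltac:(lra)). fold c2 in Hc. field. lra. }
  assert (0 < y0 / Z) by (apply Rdiv_lt_0_compat; lra).
  assert (Hm : 0 <= main_error r alpha k x).
  { assert (H1 := main_error_ge r alpha k x Hx).
    assert (H2 := Rpower_pos x (alpha / (INR r + 1) + k / (k + 1))). lra. }
  nra.
Qed.

(** The block bound carries (N/Z)^c0 with c0 > 0, so the top block dominates and no logarithm
    appears. The condition n > 2 keeps N >= 1, as [exponent_pair] requires. *)
Lemma small_index_range :
  exists K, 0 < K /\ forall (x : R) (B : nat), 2 <= x ->
  rsum (fun n => ind (2 < INR n <= Rpower x (1 / (INR r + 1)))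
    * (Rpower (x / INR n) (alpha / INR r)
       * ind (near (Rpower (x / INR n) ((1 - INR r) / INR r))
           (Rpower x (/ INR r) * Rpower (INR n) (- / INR r))))) B
  <= K * main_error r alpha k x.
Proof.
  assert (Hr2 := r_ge_2). assert (Hk := k_pos).
  destruct (near_count k l (/ INR r) Hkl ltac:(apply Rinv_0_lt_compat; lra)) as (A & HA & HN).
  destruct Hkl as (Hk2 & Hl & _).
  (* Balancing gives T^(1+k) = x^(k/r) N^(k (r^2-1)/r), that is T = x^(k/(k+1)) (N/Z)^c. The weight
     (x/N)^(alpha/r) consumes alpha/r of this exponent and leaves [c0]. *)
  set (c := k / (1 + k) * ((INR r * INR r - 1) / INR r)).
  set (c0 := c - alpha / INR r).
  (* k (r^2 - 1) = l (r - 1/r) is at least 3/4, while alpha <= 1/3 gives alpha (1 + k) <= 1/2. *)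
  assert (Hc0 : 0 < c0).
  { unfold c0, c. replace (_ - _) with ((k * (INR r * INR r - 1) - alpha * (1 + k)) / ((1 + k) * INR r)) by (field; lra).
    apply Rdiv_lt_0_compat; [|nra].
    assert (k * (INR r * INR r - 1) = l * INR r - k) by (rewrite Hlk; ring). nra. }
  (* The two upper bounds for [c] keep N^(1/r+1)/x^(1/r) and N d within a constant multiple of T for
     N <= Z. *)
  assert (Hc1 : c <= (INR r + 1) / INR r).
  { unfold c. replace ((INR r + 1) / INR r) with ((1 + k) / (1 + k) * ((INR r + 1) / INR r)) by (field; lra).
    replace (k / (1 + k) * ((INR r * INR r - 1) / INR r)) with ((k * (INR r - 1)) / (1 + k) * ((INR r + 1) / INR r)) by (field; lra).
    apply Rmult_le_compat_r; [apply Rlt_le, Rdiv_lt_0_compat; lra|].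
    apply Rmult_le_compat_r; [apply Rlt_le, Rinv_0_lt_compat; lra|]. nra. }
  assert (Hc2 : c <= (INR r * INR r - 1) / INR r).
  { unfold c. assert (0 <= (INR r * INR r - 1) / INR r) by (apply Rdiv_le_0_compat; nra).
    assert (k / (1 + k) <= 1).
    { apply Rmult_le_reg_r with (1 + k); [lra|]. unfold Rdiv. rewrite Rmult_assoc, Rinv_l; lra. }
    nra. }
  assert (H2c := Rpower_2_gt_1 c0 Hc0).
  (* 5 = 2 + 1 + 1 + 1: N d <= 2 T and T for each of the other three terms of [near_count]; the
     denominator belongs to the geometric primitive. *)
  set (K := 5 * A / (Rpower 2 c0 - 1)).
  assert (HK : 0 < K) by (apply Rdiv_lt_0_compat; lra).
  exists (K * 2). split; [lra|]. intros x B Hx.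
  set (Z := Rpower x (1 / (INR r + 1))).
  set (M := Rpower x (alpha / (INR r + 1) + k / (k + 1))).
  assert (HM : 0 < M) by apply Rpower_pos.
  assert (HZ : 1 <= Z).
  { apply Rpower_ge_1; [lra|]. apply Rdiv_le_0_compat; lra. }
  rewrite Rmult_assoc. eapply Rle_trans; [|apply Rmult_le_compat_l; [lra|apply main_error_ge; exact Hx]].
  fold M. set (Phi := fun N => K * M * Rpower (N / Z) c0).
  replace (K * M) with (Phi Z).
  2:{ unfold Phi. replace (Z / Z) with 1 by (field; lra). unfold Rpower at 1. rewrite ln_1, Rmult_0_r, exp_0. ring. }
  apply dyadic_sum; try lra.
  - intros N _. unfold Phi. assert (H := Rpower_pos (N / Z) c0). apply Rmult_le_pos; nra.
  - intros n. apply Rmult_le_pos; [apply Rlt_le, Rpower_pos|apply ind_bounds].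
  - intros N HN1 HNZ. assert (HN1' : 1 <= N) by lra. clear HN1.
    set (T := Rpower x (k / (k + 1)) * Rpower (N / Z) c).
    assert (HT : 0 < T) by (apply Rmult_lt_0_compat; apply Rpower_pos).
    (* The factor 2 covers n up to 2N, as the exponent (1 - r)/r lies in [-1, 0]. *)
    set (d := 2 * Rpower (x / N) ((1 - INR r) / INR r)).
    assert (Hd : 0 < d) by (assert (H := Rpower_pos (x / N) ((1 - INR r) / INR r)); unfold d; lra).
    assert (Hq : - 1 <= (1 - INR r) / INR r <= 0).
    { split; apply Rmult_le_reg_r with (INR r); try lra; unfold Rdiv; rewrite Rmult_assoc, Rinv_l; lra. }
    apply Rle_trans with (Rpower (x / N) (alpha / INR r) *
      rsum (fun n => block N n * ind (near d (Rpower x (/ INR r) * Rpower (INR n) (- / INR r)))) B).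
    { rewrite <- rsum_scal. apply rsum_le; intros n _. unfold block.
      destruct (classic (N < INR n <= 2 * N)) as [Hn|Hn].
      2:{ rewrite (ind_false _ Hn). lra. }
      rewrite (ind_true _ Hn), !Rmult_1_l.
      assert (Hxn : 0 < x / INR n) by (apply Rdiv_lt_0_compat; lra).
      apply Rmult_le_compat.
      - apply Rlt_le, Rpower_pos.
      - apply ind_bounds.
      - apply Rle_Rpower_l; [apply Rdiv_le_0_compat; lra|]. split; [exact Hxn|].
        apply Rmult_le_compat_l; [lra|]. apply Rinv_le_contravar; lra.
      - apply ind_le, near_le. unfold d.
        apply Rle_trans with (Rpower (/ 2 * (x / N)) ((1 - INR r) / INR r)).
        + apply Rpower_antitone; [|lra]. split; [apply Rmult_lt_0_compat; [lra|apply Rdiv_lt_0_compat; lra]|].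
          replace (/ 2 * (x / N)) with (x * / (2 * N)) by (field; lra).
          apply Rmult_le_compat_l; [lra|]. apply Rinv_le_contravar; lra.
        + rewrite <- Rpower_mult_distr by (try apply Rdiv_lt_0_compat; lra).
          apply Rmult_le_compat_r; [apply Rlt_le, Rpower_pos|].
          unfold Rpower. rewrite ln_Rinv by lra.
          rewrite <- (exp_ln 2) at 2 by lra. apply exp_le_compat.
          assert (H2 := ln_2_bounds). nra. }
    specialize (HN N (Rpower x (/ INR r)) T d B ltac:(lra) (Rpower_pos _ _) HT Hd).
    assert (HNa := Rpower_pos (x / N) (alpha / INR r)).
    eapply Rle_trans; [apply Rmult_le_compat_l; [lra|exact HN]|]. clear HN.
    set (u := ln N). assert (EN : N = exp u) by (unfold u; rewrite exp_ln; lra).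
    (* [w] is ln (Z/N) >= 0; x, N, Z and T are all expressed through [u] and [w]. *)
    set (w := ln x / (INR r + 1) - u).
    assert (Ex : x = exp ((INR r + 1) * (u + w))).
    { replace ((INR r + 1) * (u + w)) with (ln x) by (unfold w; field; lra). rewrite exp_ln; lra. }
    assert (Hu : 0 <= u) by (unfold u; rewrite <- ln_1; apply ln_le; lra).
    assert (Hw : 0 <= w).
    { assert (H : u <= ln Z) by (apply ln_le; lra).
      unfold Z, Rpower in H. rewrite ln_exp in H. unfold w.
      replace (ln x / (INR r + 1)) with (1 / (INR r + 1) * ln x) by (field; lra). lra. }
    assert (EZ : Z = exp (u + w)).
    { unfold Z. rewrite Ex, Rpower_exp. f_equal. field; lra. }
    assert (ET : T = exp (k / (k + 1) * ((INR r + 1) * (u + w)) - c * w)).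
    { unfold T. rewrite EZ, Ex, EN. to_exp. f_equal. ring. }
    assert (Hkk : 0 <= k / (k + 1) * ((INR r + 1) * (u + w))).
    { apply Rmult_le_pos; [apply Rdiv_le_0_compat; lra|nra]. }
    assert (H1 : N * d <= 2 * T).
    { unfold d. replace (N * (2 * Rpower (x / N) ((1 - INR r) / INR r)))
        with (2 * (N * Rpower (x / N) ((1 - INR r) / INR r))) by ring.
      apply Rmult_le_compat_l; [lra|]. rewrite ET, Ex, EN. to_exp. apply exp_le_compat.
      replace (u + (1 - INR r) * / INR r * ((INR r + 1) * (u + w) + - u))
        with ((2 - INR r) * u - (INR r * INR r - 1) / INR r * w) by (field; lra).
      unfold Rdiv in *. nra. }
    assert (H3 : Rpower (N / T * Rpower x (/ INR r) * Rpower N (- / INR r - 1)) k * Rpower N l = T).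
    { rewrite ET, Ex, EN, Hlk. to_exp. f_equal. unfold c. field. lra. }
    assert (H4 : Rpower N (/ INR r + 1) / Rpower x (/ INR r) <= T).
    { rewrite ET, Ex, EN. to_exp. apply exp_le_compat.
      replace ((/ INR r + 1) * u + - (/ INR r * ((INR r + 1) * (u + w))))
        with (- ((INR r + 1) / INR r * w)) by (field; lra).
      unfold Rdiv in *. nra. }
    (* (x/Z)^(alpha/r) = Z^alpha supplies the exponent alpha/(r+1) in [M]. *)
    assert (H5 : Rpower (x / N) (alpha / INR r) * T = M * Rpower (N / Z) c0).
    { unfold M. rewrite ET, EZ, Ex, EN. to_exp. f_equal. unfold c0. field. lra. }
    rewrite H3. unfold Phi.
    replace (2 * N / Z) with (2 * (N / Z)) by (field; lra).
    assert (0 < N / Z) by (apply Rdiv_lt_0_compat; lra).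
    rewrite <- Rpower_mult_distr by lra.
    apply Rle_trans with (Rpower (x / N) (alpha / INR r) * (A * (5 * T))).
    { apply Rmult_le_compat_l; [lra|]. apply Rmult_le_compat_l; lra. }
    replace (_ * (A * (5 * T))) with (5 * A * (Rpower (x / N) (alpha / INR r) * T)) by ring.
    rewrite H5. unfold K. right. field. lra.
Qed.
End Ranges.

(** * Finite complex sums *)

Fixpoint csum (F : nat -> C) (n : nat) : C :=
  match n with O => RtoC 0 | S m => Cplus (csum F m) (F (S m)) end.

Lemma csum_ext (F G : nat -> C) n :
  (forall i, (1 <= i <= n)%nat -> F i = G i) -> csum F n = csum G n.
Proof.
  induction n as [|n IH]; intros H; simpl; [reflexivity|].
  rewrite (H (S n)) by lia. rewrite IH; [reflexivity|]. intros; apply H; lia.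
Qed.

Lemma csum_plus (F G : nat -> C) n :
  csum (fun i => Cplus (F i) (G i)) n = Cplus (csum F n) (csum G n).
Proof. induction n as [|n IH]; simpl; [ring|rewrite IH; ring]. Qed.

Lemma csum_scal (c : C) (F : nat -> C) n :
  csum (fun i => Cmult c (F i)) n = Cmult c (csum F n).
Proof. induction n as [|n IH]; simpl; [ring|rewrite IH; ring]. Qed.

Lemma csum_0 n : csum (fun _ => RtoC 0) n = RtoC 0.
Proof. induction n as [|n IH]; simpl; [reflexivity|rewrite IH; ring]. Qed.

Lemma csum_swap (F : nat -> nat -> C) n m :
  csum (fun i => csum (fun j => F i j) m) n = csum (fun j => csum (fun i => F i j) n) m.
Proof.
  induction n as [|n IH]; simpl; [now rewrite csum_0|].
  rewrite IH, <- csum_plus. reflexivity.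
Qed.

Lemma csum_RtoC (F : nat -> R) n : csum (fun i => RtoC (F i)) n = RtoC (rsum F n).
Proof. induction n as [|n IH]; simpl; [reflexivity|rewrite IH, RtoC_plus; reflexivity]. Qed.

Lemma Cmod_csum (F : nat -> C) n : Cmod (csum F n) <= rsum (fun i => Cmod (F i)) n.
Proof.
  induction n as [|n IH]; simpl; [rewrite Cmod_0; lra|].
  eapply Rle_trans; [apply Cmod_triangle|lra].
Qed.

Lemma csum_single (F : nat -> C) a n : (1 <= a <= n)%nat ->
  csum (fun i => Cmult (F i) (RtoC (ind (a = i)))) n = F a.
Proof.
  induction n as [|n IH]; intros H; [lia|]. simpl.
  destruct (Nat.eq_dec a (S n)) as [->|Hne].
  - rewrite (csum_ext _ (fun _ => RtoC 0)).
    + rewrite csum_0, (ind_true _ eq_refl). ring.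
    + intros i Hi. rewrite ind_false by lia. ring.
  - rewrite IH, ind_false by lia. ring.
Qed.

Lemma Csum_csum (F : nat -> C) n : Csum 1 n F = csum F n.
Proof.
  unfold Csum.
  assert (H : forall m, (m <= n)%nat ->
    Csum_upto (fun i => if andb (1 <=? i)%nat (i <=? n)%nat then F i else RtoC 0) m = csum F m).
  { induction m as [|m IH]; intros Hm; [reflexivity|].
    change (csum F (S m)) with (Cplus (csum F m) (F (S m))). rewrite <- IH by lia.
    cbn [Csum_upto]. destruct (Nat.leb_spec 1 (S m)), (Nat.leb_spec (S m) n); try lia. reflexivity. }
  apply H; lia.
Qed.

Lemma rsum_term_le (F : nat -> R) i n :
  (forall j, 0 <= F j) -> (1 <= i <= n)%nat -> F i <= rsum F n.
Proof.
  intros HF. induction n as [|n IH]; intros H; [lia|]. simpl.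
  destruct (Nat.eq_dec i (S n)) as [->|Hne].
  - assert (0 <= rsum F n) by (apply rsum_nonneg; intros; apply HF). lra.
  - specialize (HF (S n)). specialize (IH ltac:(lia)). lra.
Qed.

(** * Size of f, its partial sums and its weighted tails *)

Definition is_power (r m : nat) : Prop := exists d, (1 <= d)%nat /\ (d ^ r = m)%nat.

(** The root d = m^(1/r) turns d^alpha into m^(alpha/r), and injectivity of the r-th power leaves at
    most one term in the sum defining [f_of]. *)
Lemma f_of_bound (r : nat) (h : nat -> C) (alpha C0 : R) (m : nat) :
  (1 <= r)%nat -> 0 <= C0 ->
  (forall d, (1 <= d)%nat -> Cmod (h d) <= C0 * Rpower (INR d) alpha) ->
  Cmod (f_of r h m) <= C0 * Rpower (INR m) (alpha / INR r) * ind (is_power r m).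
Proof.
  intros Hr HC0 Hh. unfold f_of. rewrite Csum_csum.
  eapply Rle_trans; [apply Cmod_csum|].
  assert (Hm := Rpower_pos (INR m) (alpha / INR r)).
  assert (HrR : 1 <= INR r) by (apply (le_INR 1); lia).
  apply Rle_trans with (rsum (fun d => C0 * Rpower (INR m) (alpha / INR r) * ind (is_power r m)
                                       * ind (d ^ r = m)%nat) m).
  - apply rsum_le; intros d Hd. destruct (Nat.eqb_spec (d ^ r) m) as [E|E].
    + rewrite (ind_true _ E), ind_true by (exists d; lia). rewrite !Rmult_1_r.
      replace (Rpower (INR m) (alpha / INR r)) with (Rpower (INR d) alpha); [apply Hh; lia|].
      assert (0 < INR d) by (apply lt_0_INR; lia).
      rewrite <- E, pow_INR, <- Rpower_pow, Rpower_mult by assumption. f_equal. field. lra.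
    + rewrite Cmod_0, (ind_false _ E). lra.
  - rewrite rsum_scal. assert (0 <= ind (is_power r m)) by apply ind_bounds.
    assert (rsum (fun d => ind (d ^ r = m)%nat) m <= 1).
    { apply rsum_ind_eq_le. intros i j Hi Hj.
      assert (Hij : (i ^ r = j ^ r)%nat) by congruence. clear - Hij Hr.
      destruct (Nat.lt_trichotomy i j) as [H|[H|H]]; [|assumption|];
        apply (fun H => Nat.pow_lt_mono_l _ _ r H) in H; lia. }
    rewrite <- (Rmult_1_r (C0 * _ * _)) at 2. apply Rmult_le_compat_l; [|assumption].
    repeat apply Rmult_le_pos; lra.
Qed.

Lemma Rpower_root_le (r d : nat) (y : R) :
  (1 <= r)%nat -> (1 <= d)%nat -> INR (d ^ r) <= y -> INR d <= Rpower y (1 / INR r).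
Proof.
  intros Hr Hd H. assert (0 < INR d) by (apply lt_0_INR; lia).
  assert (HrR : 1 <= INR r) by (apply (le_INR 1); lia).
  rewrite pow_INR, <- Rpower_pow in H by assumption.
  rewrite <- (Rpower_1 (INR d)) by assumption.
  replace 1 with (INR r * (1 / INR r)) at 1 by (field; lra).
  rewrite <- Rpower_mult. apply Rle_Rpower_l; [apply Rdiv_le_0_compat; lra|].
  split; [apply Rpower_pos|exact H].
Qed.

(** Double count of the pairs with d^r = m: each r-th power m has its root within [D], and each d
    has one power. *)
Lemma power_count (r M : nat) : (1 <= r)%nat ->
  rsum (fun m => ind (is_power r m)) M <= Rpower (INR M) (1 / INR r).
Proof.
  intros Hr. set (D := nfloor (Rpower (INR M) (1 / INR r))).
  assert (HM := Rpower_pos (INR M) (1 / INR r)).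
  apply Rle_trans with (rsum (fun m => rsum (fun d => ind (d ^ r = m)%nat) D) M).
  - apply rsum_le; intros m Hm. destruct (classic (is_power r m)) as [Hp|Hp].
    + rewrite (ind_true _ Hp). destruct Hp as (d & Hd & E).
      rewrite <- (ind_true _ E). apply (rsum_term_le (fun d => ind (d ^ r = m)%nat)).
      * intros; apply ind_bounds.
      * split; [assumption|]. apply le_nfloor, Rpower_root_le; try assumption.
        rewrite E. apply le_INR; lia.
    + rewrite (ind_false _ Hp). apply rsum_nonneg; intros; apply ind_bounds.
  - rewrite rsum_swap. apply Rle_trans with (rsum (fun _ => 1) D).
    + apply rsum_le; intros d _. apply rsum_ind_eq_le. congruence.
    + rewrite rsum_const, Rmult_1_r. apply INR_nfloor. lra.
Qed.

Lemma f_of_sum_bound (r : nat) (h : nat -> C) (alpha C0 : R) (M : nat) :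
  (1 <= r)%nat -> 0 <= C0 -> 0 <= alpha -> (1 <= M)%nat ->
  (forall d, (1 <= d)%nat -> Cmod (h d) <= C0 * Rpower (INR d) alpha) ->
  rsum (fun m => Cmod (f_of r h m)) M <= C0 * Rpower (INR M) ((1 + alpha) / INR r).
Proof.
  intros Hr HC0 Ha HM Hh.
  assert (HrR : 1 <= INR r) by (apply (le_INR 1); lia).
  assert (HMR : 1 <= INR M) by (apply (le_INR 1); lia).
  assert (HP := Rpower_pos (INR M) (alpha / INR r)).
  apply Rle_trans with (rsum (fun m => C0 * Rpower (INR M) (alpha / INR r) * ind (is_power r m)) M).
  - apply rsum_le; intros m Hm. eapply Rle_trans; [apply f_of_bound with (1 := Hr) (2 := HC0) (3 := Hh)|].
    apply Rmult_le_compat_r; [apply ind_bounds|]. apply Rmult_le_compat_l; [exact HC0|].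
    apply Rle_Rpower_l; [apply Rdiv_le_0_compat; lra|]. split; [apply lt_0_INR; lia|apply le_INR; lia].
  - rewrite rsum_scal. replace ((1 + alpha) / INR r) with (alpha / INR r + 1 / INR r) by (field; lra).
    rewrite Rpower_plus, <- Rmult_assoc. apply Rmult_le_compat_l; [nra|]. now apply power_count.
Qed.

(* Summation by parts; the induction carries the boundary term rsum g b / ((b+1)(b+2)). *)
Lemma weighted_tail_bound (g : nat -> R) (C0 beta : R) (a b : nat) :
  (forall m, 0 <= g m) -> 0 <= C0 -> beta <= 1 ->
  (forall M, (1 <= M)%nat -> rsum g M <= C0 * Rpower (INR M) beta) ->
  (1 <= a <= b)%nat ->
  rsum (fun m => g m / (INR m * INR (S m))) b - rsum (fun m => g m / (INR m * INR (S m))) a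
  <= 3 * C0 * (Rpower (INR a) (beta - 1) / INR a).
Proof.
  intros Hg HC0 Hb HF [Ha Hab].
  set (U := rsum (fun m => g m / (INR m * INR (S m)))).
  set (P := Rpower (INR a) (beta - 1)).
  assert (HP : 0 < P) by apply Rpower_pos.
  assert (HaR : 1 <= INR a) by (apply (le_INR 1); lia).
  (* As beta <= 1, b^beta <= b a^(beta-1) for b >= a. With a bound linear in b the summation by
     parts involves rational functions only. *)
  assert (HFb : forall b, (a <= b)%nat -> rsum g b <= C0 * (INR b * P)).
  { intros c Hc. eapply Rle_trans; [apply HF; lia|]. apply Rmult_le_compat_l; [exact HC0|].
    assert (HcR : INR a <= INR c) by now apply le_INR.
    replace beta with (1 + (beta - 1)) by ring. rewrite Rpower_plus, Rpower_1 by lra.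
    apply Rmult_le_compat_l; [lra|]. apply Rpower_antitone; lra. }
  assert (HI : U b - U a <= rsum g b / ((INR b + 1) * (INR b + 2))
                 + 2 * C0 * P * (1 / (INR a + 1) - 1 / (INR b + 1))).
  { induction Hab as [|b Hab IH].
    - assert (0 <= rsum g a) by (apply rsum_nonneg; intros; apply Hg).
      assert (0 <= rsum g a / ((INR a + 1) * (INR a + 2))) by (apply Rdiv_le_0_compat; nra). lra.
    - assert (HbR : INR a <= INR b) by now apply le_INR.
      specialize (HFb (S b) ltac:(lia)).
      unfold U in *. cbn [rsum] in *. set (u := rsum (fun m => g m / (INR m * INR (S m))) b) in *.
      set (F := rsum g b) in *. set (G := g (S b)) in *.
      rewrite ?S_INR in *. set (n := INR b) in *.
      assert (E : (F + G) / ((n + 1 + 1) * (n + 1 + 2)) =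
        F / ((n + 1) * (n + 2)) + G / ((n + 1) * (n + 1 + 1))
        - 2 * (F + G) / ((n + 1) * (n + 2) * (n + 3))) by (field; lra).
      rewrite E.
      assert (H1 : 2 * (F + G) / ((n + 1) * (n + 2) * (n + 3)) <= 2 * C0 * P * (1 / (n + 1) - 1 / (n + 1 + 1))).
      { replace (1 / (n + 1) - 1 / (n + 1 + 1)) with ((n + 3) / ((n + 1) * (n + 2) * (n + 3))) by (field; lra).
        replace (2 * C0 * P * ((n + 3) / ((n + 1) * (n + 2) * (n + 3))))
          with ((2 * C0 * P * (n + 3)) / ((n + 1) * (n + 2) * (n + 3))) by (field; lra).
        apply Rmult_le_compat_r; [apply Rlt_le, Rinv_0_lt_compat; repeat apply Rmult_lt_0_compat; lra|].
        assert (0 <= C0 * P) by nra. nra. }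
      lra. }
  specialize (HFb b Hab). assert (HbR : INR a <= INR b) by now apply le_INR.
  assert (Hia : 0 < / INR a) by (apply Rinv_0_lt_compat; lra).
  assert (HCP : 0 <= C0 * P) by nra.
  assert (H1 : rsum g b / ((INR b + 1) * (INR b + 2)) <= C0 * P * / INR a).
  { apply Rle_trans with (C0 * (INR b * P) / ((INR b + 1) * (INR b + 2))).
    - apply Rmult_le_compat_r; [apply Rlt_le, Rinv_0_lt_compat; nra|exact HFb].
    - replace (C0 * (INR b * P) / ((INR b + 1) * (INR b + 2)))
        with (C0 * P * (INR b / ((INR b + 1) * (INR b + 2)))) by (field; lra).
      apply Rmult_le_compat_l; [exact HCP|]. apply Rmult_le_reg_r with (INR a * ((INR b + 1) * (INR b + 2))).
      + repeat apply Rmult_lt_0_compat; lra.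
      + replace (INR b / ((INR b + 1) * (INR b + 2)) * (INR a * ((INR b + 1) * (INR b + 2)))) with (INR a * INR b) by (field; lra).
        replace (/ INR a * (INR a * ((INR b + 1) * (INR b + 2)))) with ((INR b + 1) * (INR b + 2)) by (field; lra). nra. }
  assert (H2 : 1 / (INR a + 1) - 1 / (INR b + 1) <= / INR a).
  { assert (1 / (INR a + 1) <= / INR a) by (unfold Rdiv; rewrite Rmult_1_l; apply Rinv_le_contravar; lra).
    assert (0 < 1 / (INR b + 1)) by (apply Rdiv_lt_0_compat; lra). lra. }
  unfold Rdiv. assert (2 * C0 * P * (1 / (INR a + 1) - 1 / (INR b + 1)) <= 2 * C0 * P * / INR a).
  { apply Rmult_le_compat_l; lra. }
  lra.
Qed.

(** * Integers in an interval and values of floor(x/n) *)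

Lemma count_le (b : R) (B : nat) : 0 <= b ->
  rsum (fun n => ind (INR n <= b)) B = INR (Nat.min B (nfloor b)).
Proof.
  intros Hb. induction B as [|B IH]; [reflexivity|]. cbn [rsum]. rewrite IH.
  destruct (Rle_lt_dec (INR (S B)) b) as [H|H].
  - rewrite ind_true by exact H. apply le_nfloor in H.
    rewrite !Nat.min_l by lia. rewrite S_INR. ring.
  - rewrite ind_false by lra.
    assert (nfloor b < S B)%nat.
    { apply Nat.nle_gt. intros Hc. apply le_INR in Hc. destruct (INR_nfloor b Hb). lra. }
    rewrite !Nat.min_r by lia. ring.
Qed.

(** A difference of two floors; [b < INR B + 1] ensures that the cut-off B loses no integer up to
    b. *)
Lemma count_interval (a b : R) (B : nat) : 0 <= a <= b -> b < INR B + 1 ->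
  Rabs (rsum (fun n => ind (a < INR n <= b)) B - (b - a)) <= 1.
Proof.
  intros Hab HB.
  assert (E : rsum (fun n => ind (a < INR n <= b)) B
     = rsum (fun n => ind (INR n <= b)) B - rsum (fun n => ind (INR n <= a)) B).
  { unfold Rminus. rewrite <- (Rmult_1_l (rsum (fun n => ind (INR n <= a)) B)), Ropp_mult_distr_l, <- rsum_scal, <- rsum_plus.
    apply rsum_ext; intros n _.
    destruct (Rle_lt_dec (INR n) a), (Rle_lt_dec (INR n) b).
    - rewrite (ind_false (_ /\ _)), !ind_true; lra.
    - lra.
    - rewrite (ind_true (_ /\ _)), (ind_true (_ <= b)), (ind_false (_ <= a)); lra.
    - rewrite !ind_false; lra. }
  rewrite E, !count_le by lra.
  assert (Hf : forall c, 0 <= c <= b -> (nfloor c <= B)%nat).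
  { intros c Hc. destruct (INR_nfloor c); [lra|]. apply Nat.lt_succ_r, INR_lt. rewrite S_INR. lra. }
  rewrite !Nat.min_r by (apply Hf; lra).
  destruct (INR_nfloor a); [lra|]. destruct (INR_nfloor b); [lra|].
  apply Rabs_le; lra.
Qed.

Lemma nfloor_div_eq (x : R) (n m : nat) : 0 <= x -> (1 <= n)%nat -> (1 <= m)%nat ->
  (nfloor (x / INR n) = m <-> x / (INR m + 1) < INR n <= x / INR m).
Proof.
  intros Hx Hn Hm.
  assert (HnR : 1 <= INR n) by (apply (le_INR 1); lia).
  assert (HmR : 1 <= INR m) by (apply (le_INR 1); lia).
  assert (Hq : 0 <= x / INR n) by (apply Rdiv_le_0_compat; lra).
  assert (E1 : x / INR n * INR n = x) by (field; lra).
  assert (E2 : x / INR m * INR m = x) by (field; lra).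
  assert (E3 : x / (INR m + 1) * (INR m + 1) = x) by (field; lra).
  split.
  - intros E. destruct (INR_nfloor _ Hq) as [H1 H2]. rewrite E in H1, H2. split.
    + apply Rmult_lt_reg_r with (INR m + 1); [lra|]. nra.
    + apply Rmult_le_reg_r with (INR m); [lra|]. nra.
  - intros [H1 H2].
    assert (H3 : INR m <= x / INR n) by (apply Rmult_le_reg_r with (INR n); [lra|]; nra).
    assert (H4 : x / INR n < INR m + 1) by (apply Rmult_lt_reg_r with (INR n); [lra|]; nra).
    apply le_nfloor in H3. destruct (INR_nfloor _ Hq) as [H5 _].
    assert (nfloor (x / INR n) < S m)%nat by (apply INR_lt; rewrite S_INR; lra). lia.
Qed.

(** * Convergence of C_f and the small quotients *)

Lemma sum_n_csum (v : nat -> C) (n : nat) : sum_n (fun i => v (S i)) n = csum v (S n).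
Proof.
  induction n as [|n IH].
  - rewrite sum_O. simpl. symmetry. apply Cplus_0_l.
  - rewrite sum_Sn, IH. reflexivity.
Qed.

Lemma sum_n_rsum (v : nat -> R) (n : nat) : sum_n (fun i => v (S i)) n = rsum v (S n).
Proof.
  induction n as [|n IH].
  - rewrite sum_O. simpl. ring.
  - rewrite sum_Sn, IH. reflexivity.
Qed.

(** One uniform bound on the sums of moduli serves twice: at a = 1 it gives absolute convergence,
    and as b tends to infinity it gives the tail estimate. *)
Lemma series_with_tail (v : nat -> C) (t : nat -> R) :
  (forall a b, (1 <= a <= b)%nat ->
     rsum (fun m => Cmod (v m)) b - rsum (fun m => Cmod (v m)) a <= t a) ->
  exists s : C, is_series (fun n => v (S n)) s
    /\ forall a, (1 <= a)%nat -> Cmod (Cminus (csum v a) s) <= t a.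
Proof.
  intros Ht. set (V := rsum (fun m => Cmod (v m))) in *.
  assert (Hex : ex_series (fun n => v (S n))).
  { apply (@ex_series_le C_AbsRing C_CompleteNormedModule _ (fun n => Cmod (v (S n)))).
    - intros n. apply Rle_refl.
    - destruct (ex_finite_lim_seq_incr (sum_n (fun n => Cmod (v (S n)))) (V 1%nat + t 1%nat)) as [s Hs].
      + intros n. rewrite sum_Sn. assert (H := Cmod_ge_0 (v (S (S n)))). unfold plus; simpl. lra.
      + intros n. rewrite (sum_n_rsum (fun m => Cmod (v m))).
        specialize (Ht 1%nat (S n) ltac:(lia)). fold V. lra.
      + exists s. exact Hs. }
  destruct Hex as [s Hs]. exists s. split; [exact Hs|]. intros a Ha.
  apply le_epsilon; intros eps Heps.
  assert (Hs' := proj1 (filterlim_locally_ball_norm _ _) Hs (mkposreal eps Heps)).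
  destruct Hs' as [N HN]. specialize (HN (a + N)%nat ltac:(lia)).
  unfold ball_norm in HN. rewrite sum_n_csum in HN.
  change (Cmod (Cminus (csum v (S (a + N))) s) < eps) in HN.
  assert (Hd : forall b, (a <= b)%nat -> Cmod (Cminus (csum v a) (csum v b)) <= V b - V a).
  { intros b Hb. induction Hb as [|b Hb IH].
    - replace (Cminus (csum v a) (csum v a)) with (RtoC 0) by ring. rewrite Cmod_0. lra.
    - unfold V in *. cbn [csum rsum].
      replace (Cminus (csum v a) (Cplus (csum v b) (v (S b))))
        with (Cplus (Cminus (csum v a) (csum v b)) (Copp (v (S b)))) by ring.
      eapply Rle_trans; [apply Cmod_triangle|]. rewrite Cmod_opp. lra. }
  specialize (Hd (S (a + N)) ltac:(lia)). specialize (Ht a (S (a + N)) ltac:(lia)).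
  replace (Cminus (csum v a) s)
    with (Cplus (Cminus (csum v a) (csum v (S (a + N)))) (Cminus (csum v (S (a + N))) s)) by ring.
  eapply Rle_trans; [apply Cmod_triangle|]. lra.
Qed.

Lemma nfloor_div_ge_1 (x : R) (n : nat) : 0 <= x -> (1 <= n <= nfloor x)%nat ->
  (1 <= nfloor (x / INR n))%nat.
Proof.
  intros Hx Hn. apply le_nfloor. simpl. assert (1 <= INR n) by (apply (le_INR 1); lia).
  destruct (INR_nfloor x Hx). assert (INR n <= INR (nfloor x)) by (apply le_INR; lia).
  apply Rmult_le_reg_r with (INR n); [lra|]. replace (x / INR n * INR n) with x by (field; lra). lra.
Qed.

(** The main term is x times a partial sum of C_f because x/m - x/(m+1) = x/(m(m+1)); each m costs
    an error of at most |f m|. The cut-off M is left open. *)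
Lemma small_quotient_sum (f : nat -> C) (x : R) (M : nat) : 0 <= x ->
  Cmod (Cminus
    (csum (fun n => Cmult (f (nfloor (x / INR n))) (RtoC (ind (nfloor (x / INR n) <= M)%nat))) (nfloor x))
    (Cmult (csum (fun m => Cdiv (f m) (RtoC (INR m * INR (S m)))) M) (RtoC x)))
  <= rsum (fun m => Cmod (f m)) M.
Proof.
  intros Hx. set (c := fun m => rsum (fun n => ind (nfloor (x / INR n) = m)) (nfloor x)).
  assert (E1 : csum (fun n => Cmult (f (nfloor (x / INR n))) (RtoC (ind (nfloor (x / INR n) <= M)%nat))) (nfloor x)
    = csum (fun m => Cmult (f m) (RtoC (c m))) M).
  { rewrite (csum_ext _ (fun n => csum (fun m => Cmult (f m) (RtoC (ind (nfloor (x / INR n) = m)))) M)).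
    - rewrite csum_swap. apply csum_ext; intros m _. now rewrite csum_scal, csum_RtoC.
    - intros n Hn. assert (H1 := nfloor_div_ge_1 x n Hx Hn).
      destruct (Nat.le_gt_cases (nfloor (x / INR n)) M) as [H|H].
      + rewrite ind_true by exact H. rewrite csum_single by lia. ring.
      + rewrite ind_false by lia. rewrite (csum_ext _ (fun _ => RtoC 0)).
        * rewrite csum_0. ring.
        * intros m Hm. rewrite ind_false by lia. ring. }
  assert (E2 : Cminus (csum (fun m => Cmult (f m) (RtoC (c m))) M)
      (Cmult (csum (fun m => Cdiv (f m) (RtoC (INR m * INR (S m)))) M) (RtoC x))
    = csum (fun m => Cmult (f m) (RtoC (c m - (x / INR m - x / (INR m + 1))))) M).
  { transitivity (Cplus (csum (fun m => Cmult (f m) (RtoC (c m))) M)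
      (csum (fun m => Cmult (RtoC (- x)) (Cdiv (f m) (RtoC (INR m * INR (S m))))) M)).
    { rewrite csum_scal, RtoC_opp. ring. }
    rewrite <- csum_plus. apply csum_ext; intros m Hm. assert (1 <= INR m) by (apply (le_INR 1); lia).
    replace (x / INR m - x / (INR m + 1)) with (x * / (INR m * INR (S m))) by (rewrite S_INR; field; lra).
    unfold Cdiv. rewrite <- RtoC_inv by (rewrite S_INR; nra).
    rewrite RtoC_minus, RtoC_mult, RtoC_opp. ring. }
  rewrite E1, E2. eapply Rle_trans; [apply Cmod_csum|]. apply rsum_le; intros m Hm.
  rewrite Cmod_mult, Cmod_R. rewrite <- (Rmult_1_r (Cmod (f m))) at 2.
  apply Rmult_le_compat_l; [apply Cmod_ge_0|].
  assert (HmR : 1 <= INR m) by (apply (le_INR 1); lia).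
  unfold c. rewrite (rsum_ext _ (fun n => ind (x / (INR m + 1) < INR n <= x / INR m))).
  - apply count_interval.
    + split; [apply Rdiv_le_0_compat; lra|]. apply Rmult_le_compat_l; [lra|]. apply Rinv_le_contravar; lra.
    + destruct (INR_nfloor x Hx). apply Rle_lt_trans with x; [|lra].
      rewrite <- (Rmult_1_r x) at 2. apply Rmult_le_compat_l; [lra|].
      rewrite <- Rinv_1. apply Rinv_le_contravar; lra.
  - intros n Hn. apply Rle_antisym; apply ind_le; apply nfloor_div_eq; try lia; lra.
Qed.

(** * Back from near-integers to f, and the assembly *)

Section Assembly.
Variables (r : nat) (h : nat -> C) (alpha k l C0 : R).
Hypothesis Hr : (2 <= r)%nat.
Hypothesis Halpha : 0 <= alpha <= 1 / 3.
Hypothesis Hkl : exponent_pair k l.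
Hypothesis Hlk : l = INR r * k.
Hypothesis HC0 : 0 <= C0.
Hypothesis Hh : forall d, (1 <= d)%nat -> Cmod (h d) <= C0 * Rpower (INR d) alpha.

Let f := f_of r h.
Let Hr2 : 2 <= INR r := le_INR 2 r Hr.
Let Hr1 : (1 <= r)%nat := Nat.le_trans 1 2 r (le_S 1 1 (le_n 1)) Hr.

(** With y = x/n, th = y^(1/r) and y - 1 < d^r <= y, one has (th - d) th^(r-1) <= th^r - d^r < 1,
    and th^(1-r) is the stated width. *)
Lemma power_quotient_near (x : R) (n : nat) : 0 < x -> (1 <= n)%nat ->
  is_power r (nfloor (x / INR n)) ->
  near (Rpower (x / INR n) ((1 - INR r) / INR r)) (Rpower x (/ INR r) * Rpower (INR n) (- / INR r)).
Proof.
  intros Hx Hn (d & Hd & E). exists d.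
  assert (HnR : 1 <= INR n) by (apply (le_INR 1); lia).
  assert (HdR : 1 <= INR d) by (apply (le_INR 1); lia).
  set (y := x / INR n) in *. assert (Hy : 0 < y) by (apply Rdiv_lt_0_compat; lra).
  destruct (INR_nfloor y) as [H1 H2]; [lra|]. rewrite <- E in H1, H2.
  assert (Et : Rpower x (/ INR r) * Rpower (INR n) (- / INR r) = Rpower y (1 / INR r)).
  { unfold y, Rdiv. rewrite <- Rpower_mult_distr by (try apply Rinv_0_lt_compat; lra).
    rewrite Rmult_1_l. f_equal. unfold Rpower. rewrite ln_Rinv by lra. f_equal. ring. }
  rewrite Et. set (th := Rpower y (1 / INR r)).
  assert (Hth : INR d <= th) by (apply Rpower_root_le; assumption).
  set (P := Rpower th (INR r - 1)). assert (HP : 0 < P) by apply Rpower_pos.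
  assert (HthP : th * P = y).
  { unfold P. rewrite <- (Rpower_1 th) at 1 by lra. rewrite <- Rpower_plus.
    unfold th. rewrite Rpower_mult. replace (1 / INR r * (1 + (INR r - 1))) with 1 by (field; lra).
    now apply Rpower_1. }
  assert (HdP : INR (d ^ r) <= INR d * P).
  { rewrite pow_INR, <- Rpower_pow by lra.
    replace (INR r) with (1 + (INR r - 1)) by ring. rewrite Rpower_plus, Rpower_1 by lra.
    apply Rmult_le_compat_l; [lra|]. apply Rle_Rpower_l; lra. }
  replace (Rpower y ((1 - INR r) / INR r)) with (/ P).
  2:{ unfold P, th. rewrite Rpower_mult, <- Rpower_Ropp. f_equal. field. lra. }
  rewrite Rabs_pos_eq by lra. apply Rmult_le_reg_r with P; [exact HP|].
  rewrite Rinv_l by lra. nra.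
Qed.

Lemma small_index_sum :
  exists K, 0 < K /\ forall x, 2 <= x ->
  rsum (fun n => ind (INR n <= Rpower x (1 / (INR r + 1))) * Cmod (f (nfloor (x / INR n)))) (nfloor x)
  <= K * (main_error r alpha k x + Rpower x ((1 + alpha) / (2 * INR r))).
Proof.
  destruct (small_index_range r alpha k l Hr Halpha Hkl Hlk) as (K & HK & HR).
  exists (C0 * K + 2 * C0 + 1). split; [nra|]. intros x Hx.
  set (Z := Rpower x (1 / (INR r + 1))).
  specialize (HR x (nfloor x) Hx). fold Z in HR.
  set (W := fun n => ind (2 < INR n <= Z) * (Rpower (x / INR n) (alpha / INR r)
       * ind (near (Rpower (x / INR n) ((1 - INR r) / INR r))
           (Rpower x (/ INR r) * Rpower (INR n) (- / INR r))))) in HR.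
  set (E2 := Rpower x ((1 + alpha) / (2 * INR r))).
  assert (HE2 : 0 < E2) by apply Rpower_pos.
  assert (Har : 0 <= alpha / INR r) by (apply Rdiv_le_0_compat; lra).
  (* n = 1 and n = 2 lie outside the dyadic range; each costs at most C0 x^(alpha/r), and alpha/r <=
     (1+alpha)/(2r). *)
  apply Rle_trans with (rsum (fun n => C0 * (E2 * ind (n = 1%nat) + E2 * ind (n = 2%nat) + W n)) (nfloor x)).
  - apply rsum_le; intros n Hn.
    assert (HnR : 1 <= INR n) by (apply (le_INR 1); lia).
    assert (HW : 0 <= W n).
    { unfold W. repeat apply Rmult_le_pos; try apply ind_bounds. apply Rlt_le, Rpower_pos. }
    assert (Hi1 := ind_bounds (n = 1%nat)). assert (Hi2 := ind_bounds (n = 2%nat)).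
    destruct (classic (INR n <= Z)) as [HnZ|HnZ].
    2:{ rewrite (ind_false _ HnZ), Rmult_0_l. apply Rmult_le_pos; nra. }
    rewrite (ind_true _ HnZ), Rmult_1_l.
    eapply Rle_trans; [apply (f_of_bound r h alpha C0); assumption|].
    rewrite Rmult_assoc. apply Rmult_le_compat_l; [exact HC0|].
    destruct (classic (is_power r (nfloor (x / INR n)))) as [Hp|Hp].
    2:{ rewrite (ind_false _ Hp), Rmult_0_r. nra. }
    rewrite (ind_true _ Hp), Rmult_1_r.
    assert (Hq : 0 < x / INR n) by (apply Rdiv_lt_0_compat; lra).
    assert (Hm1 := nfloor_div_ge_1 x n ltac:(lra) Hn).
    assert (Hle : Rpower (INR (nfloor (x / INR n))) (alpha / INR r) <= Rpower (x / INR n) (alpha / INR r)).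
    { apply Rle_Rpower_l; [exact Har|]. split; [apply lt_0_INR; lia|apply INR_nfloor; lra]. }
    destruct (Nat.le_gt_cases n 2) as [Hn2|Hn2].
    + assert (Rpower (x / INR n) (alpha / INR r) <= E2).
      { apply Rle_trans with (Rpower x (alpha / INR r)).
        - apply Rle_Rpower_l; [exact Har|]. split; [exact Hq|].
          rewrite <- (Rmult_1_r x) at 2. apply Rmult_le_compat_l; [lra|].
          rewrite <- Rinv_1. apply Rinv_le_contravar; lra.
        - apply Rle_Rpower; [lra|]. replace (alpha / INR r) with (2 * alpha / (2 * INR r)) by (field; lra).
          apply Rmult_le_compat_r; [apply Rlt_le, Rinv_0_lt_compat; lra|lra]. }
      assert (n = 1 \/ n = 2)%nat as [H1|H1] by lia; rewrite (ind_true _ H1); nra.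
    + assert (H3 : 2 < INR n) by (apply (lt_INR 2); lia).
      assert (HWn : W n = Rpower (x / INR n) (alpha / INR r)).
      { unfold W. rewrite !ind_true; [ring| |lra]. apply power_quotient_near; [lra|lia|exact Hp]. }
      rewrite HWn. nra.
  - rewrite rsum_scal, !rsum_plus, !rsum_scal.
    assert (H1 : rsum (fun n => ind (n = 1%nat)) (nfloor x) <= 1) by (apply rsum_ind_eq_le; congruence).
    assert (H2 : rsum (fun n => ind (n = 2%nat)) (nfloor x) <= 1) by (apply rsum_ind_eq_le; congruence).
    assert (Hm : 0 <= main_error r alpha k x).
    { assert (H := main_error_ge r alpha k x Hx).
      assert (H' := Rpower_pos x (alpha / (INR r + 1) + k / (k + 1))). lra. }
    set (m := main_error r alpha k x) in *.
    apply Rle_trans with (C0 * (E2 + E2 + K * m)).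
    + apply Rmult_le_compat_l; [exact HC0|]. nra.
    + assert (0 <= C0 * K) by nra. nra.
Qed.

Lemma half_root_pow (x : R) : 2 <= x ->
  Rpower x (1 / (2 * INR r)) ^ r = Rpower x (1 / 2).
Proof.
  intros Hx. rewrite <- Rpower_pow by apply Rpower_pos. rewrite Rpower_mult. f_equal. field. lra.
Qed.

Lemma half_sqr (x : R) : 2 <= x -> Rpower x (1 / 2) * Rpower x (1 / 2) = x.
Proof.
  intros Hx. rewrite <- Rpower_plus. replace (1 / 2 + 1 / 2) with 1 by field. apply Rpower_1; lra.
Qed.

(** Trades n for d: once m = d^r exceeds sqrt x, the interval (x/(m+1), x/m] is shorter than 1 and
    holds at most one n. The threshold is 2^r sqrt x, so that d exceeds the lower limit of
    [large_quotient_range]. *)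
Lemma large_quotient_sum :
  exists K, 0 < K /\ forall x, 2 <= x ->
  rsum (fun n => ind (Rpower x (1 / (INR r + 1)) < INR n
        /\ (nfloor ((2 * Rpower x (1 / (2 * INR r))) ^ r) < nfloor (x / INR n))%nat)
      * Cmod (f (nfloor (x / INR n)))) (nfloor x)
  <= K * (main_error r alpha k x + Rpower x ((1 + alpha) / (2 * INR r))).
Proof.
  destruct (large_quotient_range r alpha k l Hr Halpha Hkl Hlk) as (K & HK & HR).
  exists (C0 * K + 1). split; [nra|]. intros x Hx.
  set (Z := Rpower x (1 / (INR r + 1))) in *. set (Y := 2 * Rpower x (1 / (2 * INR r))) in *.
  specialize (HR x (nfloor x) Hx). fold Z Y in HR.
  set (W := fun d => ind (Y < INR d <= Z) * (Rpower (INR d) alpha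
       * ind (near (x * Rpower (INR d) (- (2 * INR r))) (x * Rpower (INR d) (- INR r))))) in HR.
  assert (HW : forall d, 0 <= W d).
  { intros d. unfold W. repeat apply Rmult_le_pos; try apply ind_bounds. apply Rlt_le, Rpower_pos. }
  assert (HY : 0 < Y) by (unfold Y; assert (H := Rpower_pos x (1 / (2 * INR r))); lra).
  assert (HZ : 1 <= Z) by (apply Rpower_ge_1; [lra|apply Rdiv_le_0_compat; lra]).
  set (s := Rpower x (1 / 2)). assert (Hs : s * s = x) by (apply half_sqr; lra).
  assert (Hs0 : 0 < s) by apply Rpower_pos.
  assert (HYr : s <= Y ^ r).
  { unfold Y. rewrite Rpow_mult_distr, half_root_pow by exact Hx. fold s.
    assert (1 <= 2 ^ r) by (apply pow_R1_Rle; lra). nra. }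
  assert (HZr : Rpower Z (INR r) * Z = x).
  { unfold Z. rewrite Rpower_mult, <- Rpower_plus.
    replace (1 / (INR r + 1) * INR r + 1 / (INR r + 1)) with 1 by (field; lra). apply Rpower_1; lra. }
  apply Rle_trans with (rsum (fun n => rsum (fun d => C0 * W d * ind (nfloor (x / INR n) = d ^ r)%nat) (nfloor x)) (nfloor x)).
  - apply rsum_le; intros n Hn.
    assert (HnR : 1 <= INR n) by (apply (le_INR 1); lia).
    assert (Hin' := proj1 (nfloor_div_eq x n (nfloor (x / INR n)) ltac:(lra) ltac:(lia) (nfloor_div_ge_1 x n ltac:(lra) Hn)) eq_refl).
    assert (Hpos : 0 <= rsum (fun d => C0 * W d * ind (nfloor (x / INR n) = d ^ r)%nat) (nfloor x)).
    { apply rsum_nonneg; intros d _. apply Rmult_le_pos; [|apply ind_bounds].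
      apply Rmult_le_pos; [exact HC0|apply HW]. }
    destruct (classic (Z < INR n /\ (nfloor (Y ^ r) < nfloor (x / INR n))%nat)) as [HA|HA].
    2:{ rewrite (ind_false _ HA), Rmult_0_l. exact Hpos. }
    rewrite (ind_true _ HA), Rmult_1_l. destruct HA as [HnZ HM].
    eapply Rle_trans; [apply (f_of_bound r h alpha C0); assumption|].
    destruct (classic (is_power r (nfloor (x / INR n)))) as [Hp|Hp].
    2:{ rewrite (ind_false _ Hp), Rmult_0_r. exact Hpos. }
    rewrite (ind_true _ Hp), Rmult_1_r. destruct Hp as (d & Hd & E).
    assert (HdR : 1 <= INR d) by (apply (le_INR 1); lia).
    rewrite <- E in *. apply nfloor_lt in HM; [|apply pow_le; lra].
    rewrite pow_INR in HM. rewrite pow_INR in Hin'.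
    assert (Hmr : INR d ^ r = Rpower (INR d) (INR r)) by (rewrite Rpower_pow; [reflexivity|lra]).
    assert (HdY : Y < INR d).
    { apply Rnot_le_lt. intros Hc. assert (INR d ^ r <= Y ^ r) by (apply pow_incr; lra). lra. }
    assert (Hm1 : 1 <= INR d ^ r) by (apply pow_R1_Rle; lra).
    (* n > Z and d > Z together would give n d^r > Z^(r+1) = x. *)
    assert (HdZ : INR d <= Z).
    { apply Rnot_lt_le. intros Hc.
      assert (Rpower Z (INR r) <= INR d ^ r) by (rewrite Hmr; apply Rle_Rpower_l; lra).
      destruct Hin' as [_ H2].
      assert (INR n * INR d ^ r <= x).
      { replace x with (x / INR d ^ r * INR d ^ r) by (field; lra). apply Rmult_le_compat_r; lra. }
      assert (HPZ := Rpower_pos Z (INR r)). nra. }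
    assert (HZx : Z <= x).
    { unfold Z. rewrite <- (Rpower_1 x) at 2 by lra. apply Rle_Rpower; [lra|].
      apply Rmult_le_reg_r with (INR r + 1); [lra|]. unfold Rdiv. rewrite Rmult_assoc, Rinv_l; lra. }
    eapply Rle_trans; [|apply (rsum_term_le _ d)].
    + cbv beta. rewrite ind_true by reflexivity. rewrite Rmult_1_r.
      apply Rmult_le_compat_l; [exact HC0|]. unfold W.
      rewrite !ind_true; [| |lra].
      * rewrite Rmult_1_l, Rmult_1_r, pow_INR, Hmr, Rpower_mult.
        replace (INR r * (alpha / INR r)) with alpha by (field; lra). lra.
      (* The nearby integer is n itself: 0 <= x/m - n < x/m - x/(m+1) <= x/m^2. *)
      * exists n. rewrite Rpower_Ropp, <- Hmr.
        replace (- (2 * INR r)) with (- INR r + - INR r) by ring.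
        rewrite Rpower_plus, Rpower_Ropp, <- Hmr. set (m := INR d ^ r) in *.
        unfold Rdiv in Hin'. destruct Hin' as [H1 H2]. rewrite Rabs_pos_eq by lra.
        apply Rle_trans with (x * / m - x * / (m + 1)); [lra|].
        replace (x * / m - x * / (m + 1)) with (x * (/ m * / (m + 1))) by (field; lra).
        apply Rmult_le_compat_l; [lra|]. apply Rmult_le_compat_l; [apply Rlt_le, Rinv_0_lt_compat; lra|].
        apply Rinv_le_contravar; lra.
    + intros j. apply Rmult_le_pos; [|apply ind_bounds]. apply Rmult_le_pos; [exact HC0|apply HW].
    + split; [exact Hd|]. apply le_nfloor. lra.
  - rewrite rsum_swap. apply Rle_trans with (rsum (fun d => C0 * W d) (nfloor x)).
    + apply rsum_le; intros d Hd. rewrite rsum_scal.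
      destruct (classic (Y < INR d <= Z)) as [HdY|HdY].
      2:{ unfold W. rewrite (ind_false _ HdY). lra. }
      rewrite <- (Rmult_1_r (C0 * W d)) at 2.
      apply Rmult_le_compat_l; [apply Rmult_le_pos; [exact HC0|apply HW]|].
      assert (Hdr : (1 <= d ^ r)%nat) by (apply Nat.neq_0_lt_0, Nat.pow_nonzero; lia).
      assert (Hms : s < INR (d ^ r)).
      { rewrite pow_INR. apply Rle_lt_trans with (Y ^ r); [exact HYr|].
        rewrite <- !Rpower_pow by lra. apply Rlt_Rpower_l; lra. }
      apply Rle_trans with (rsum (fun n => ind ((1 <= n)%nat /\ nfloor (x / INR n) = d ^ r)%nat) (nfloor x)).
      { apply rsum_le; intros n Hn. apply ind_le. intros; split; [lia|assumption]. }
      apply rsum_ind_eq_le. intros i j [Hi1 Hi] [Hj1 Hj].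
      apply nfloor_div_eq in Hi; [|lra|lia|lia]. apply nfloor_div_eq in Hj; [|lra|lia|lia].
      set (m := INR (d ^ r)) in *.
      assert (Hlen : x / m - x / (m + 1) < 1).
      { replace (x / m - x / (m + 1)) with (x / (m * (m + 1))) by (field; lra).
        apply Rmult_lt_reg_r with (m * (m + 1)); [nra|].
        replace (x / (m * (m + 1)) * (m * (m + 1))) with x by (field; lra). nra. }
      destruct (Nat.lt_trichotomy i j) as [H|[H|H]]; [|exact H|];
        apply (le_INR (S _)) in H; rewrite S_INR in H; lra.
    + rewrite rsum_scal. assert (H := Rmult_le_compat_l C0 _ _ HC0 HR).
      eapply Rle_trans; [exact H|].
      assert (Hm : 0 <= main_error r alpha k x).
      { assert (H1 := main_error_ge r alpha k x Hx).
        assert (H2 := Rpower_pos x (alpha / (INR r + 1) + k / (k + 1))). lra. }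
      assert (HE := Rpower_pos x ((1 + alpha) / (2 * INR r))). nra.
Qed.

(** [M] lies between sqrt x and 2^r sqrt x: the upper bound controls the grouping error, the lower
    one x times the tail of C_f, and both are of order (sqrt x)^beta = x^((1+alpha)/(2r)). *)
Lemma floor_sum_asymptotics :
  exists Cf : C,
    is_series (fun n : nat => Cdiv (f (S n)) (RtoC (INR (S n) * INR (S (S n))))) Cf /\
    exists K : R, forall x : R, 2 <= x ->
      Cmod (Cminus (S_sum f x) (Cmult Cf (RtoC x)))
        <= K * (main_error r alpha k x + Rpower x ((1 + alpha) / (2 * INR r))).
Proof.
  set (v := fun m => Cdiv (f m) (RtoC (INR m * INR (S m)))).
  set (beta := (1 + alpha) / INR r).
  assert (Hbeta : 0 <= beta <= 1).
  { unfold beta. split; [apply Rdiv_le_0_compat; lra|].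
    apply Rmult_le_reg_r with (INR r); [lra|]. unfold Rdiv. rewrite Rmult_assoc, Rinv_l; lra. }
  destruct (series_with_tail v (fun a => 3 * C0 * (Rpower (INR a) (beta - 1) / INR a))) as (Cf & HCf & Htail).
  { intros a b Hab.
    assert (Hv : forall c, rsum (fun m => Cmod (v m)) c = rsum (fun m => Cmod (f m) / (INR m * INR (S m))) c).
    { intros c. apply rsum_ext; intros m Hm. unfold v.
      assert (1 <= INR m) by (apply (le_INR 1); lia).
      assert (0 < INR m * INR (S m)) by (rewrite S_INR; nra).
      rewrite Cmod_div; [|intros Hc; apply RtoC_inj in Hc; lra].
      rewrite Cmod_R, Rabs_pos_eq; [reflexivity|lra]. }
    rewrite !Hv. apply weighted_tail_bound; try assumption; try lra.
    - intros; apply Cmod_ge_0.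
    - intros M HM. apply f_of_sum_bound; try assumption; lra. }
  exists Cf. split; [exact HCf|].
  destruct small_index_sum as (K1 & HK1 & H1). destruct large_quotient_sum as (K2 & HK2 & H2).
  exists (C0 * Rpower (2 ^ r) beta + 3 * C0 + K1 + K2). intros x Hx.
  specialize (H1 x Hx). specialize (H2 x Hx).
  set (E2 := Rpower x ((1 + alpha) / (2 * INR r))) in *.
  set (E1 := main_error r alpha k x) in *.
  set (Z := Rpower x (1 / (INR r + 1))) in *.
  set (M := nfloor ((2 * Rpower x (1 / (2 * INR r))) ^ r)) in *.
  set (s := Rpower x (1 / 2)). assert (Hs : s * s = x) by (apply half_sqr; lra).
  assert (Hs0 : 0 < s) by apply Rpower_pos.
  assert (Hs1 : 1 <= s) by (apply Rpower_ge_1; lra).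
  assert (HM : 2 ^ r * s - 1 < INR M <= 2 ^ r * s).
  { unfold M. rewrite Rpow_mult_distr, half_root_pow by exact Hx. fold s.
    assert (0 < 2 ^ r) by (apply pow_lt; lra).
    destruct (INR_nfloor (2 ^ r * s)); [nra|lra]. }
  assert (H2r : 4 <= 2 ^ r).
  { replace 4 with (2 ^ 2) by ring. apply Rle_pow; [lra|exact Hr]. }
  assert (HsM : s <= INR M) by nra.
  assert (HM1 : (1 <= M)%nat) by (apply INR_le; simpl; lra).
  assert (Esb : Rpower s beta = E2).
  { unfold s, E2, beta. rewrite Rpower_mult. f_equal. field. lra. }
  assert (HE2 : 0 < E2) by apply Rpower_pos.
  assert (HE1 : 0 <= E1).
  { assert (H := main_error_ge r alpha k x Hx).
    assert (H' := Rpower_pos x (alpha / (INR r + 1) + k / (k + 1))). unfold E1; lra. }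
  assert (B1 := small_quotient_sum f x M ltac:(lra)). fold v in B1.
  set (A1 := csum (fun n => Cmult (f (nfloor (x / INR n))) (RtoC (ind (nfloor (x / INR n) <= M)%nat))) (nfloor x)) in *.
  set (A2 := csum (fun n => Cmult (f (nfloor (x / INR n))) (RtoC (ind (M < nfloor (x / INR n))%nat))) (nfloor x)).
  assert (ES : S_sum f x = Cplus A1 A2).
  { unfold S_sum, A1, A2. rewrite Csum_csum, <- csum_plus. apply csum_ext; intros n _.
    destruct (Nat.le_gt_cases (nfloor (x / INR n)) M) as [H|H].
    - rewrite ind_true by exact H. rewrite ind_false by lia. ring.
    - rewrite ind_false by lia. rewrite ind_true by exact H. ring. }
  assert (B1' : rsum (fun m => Cmod (f m)) M <= C0 * Rpower (2 ^ r) beta * E2).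
  { eapply Rle_trans; [apply (f_of_sum_bound r h alpha C0); try assumption; lra|].
    fold beta. rewrite Rmult_assoc. apply Rmult_le_compat_l; [exact HC0|].
    rewrite <- Esb, Rpower_mult_distr by lra. apply Rle_Rpower_l; lra. }
  assert (B2 : Cmod (Cmult (Cminus (csum v M) Cf) (RtoC x)) <= 3 * C0 * E2).
  { rewrite Cmod_mult, Cmod_R, (Rabs_pos_eq x) by lra.
    apply Rle_trans with (3 * C0 * (Rpower (INR M) (beta - 1) / INR M) * x).
    - apply Rmult_le_compat_r; [lra|]. apply Htail. exact HM1.
    - rewrite Rmult_assoc. apply Rmult_le_compat_l; [lra|].
      apply Rle_trans with (Rpower s (beta - 1) / s * x).
      + apply Rmult_le_compat_r; [lra|]. apply Rmult_le_compat.
        * apply Rlt_le, Rpower_pos.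
        * apply Rlt_le, Rinv_0_lt_compat; lra.
        * apply Rpower_antitone; lra.
        * apply Rinv_le_contravar; lra.
      + rewrite <- Esb, <- Hs. replace beta with (beta - 1 + 1) at 2 by ring.
        rewrite Rpower_plus, Rpower_1 by exact Hs0. right. field. lra. }
  (* Quotients above [M] are split at n = [Z]. The sum over n <= [Z] also contains smaller
     quotients, which only enlarges the upper bound. *)
  assert (B3 : Cmod A2 <= (K1 + K2) * (E1 + E2)).
  { eapply Rle_trans; [apply Cmod_csum|].
    rewrite Rmult_plus_distr_r. eapply Rle_trans; [|apply Rplus_le_compat; [exact H1|exact H2]].
    rewrite <- rsum_plus. apply rsum_le; intros n _.
    rewrite Cmod_mult, Cmod_R, Rabs_pos_eq by apply ind_bounds.
    rewrite <- Rmult_plus_distr_r, Rmult_comm. apply Rmult_le_compat_r; [apply Cmod_ge_0|].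
    destruct (classic (M < nfloor (x / INR n))%nat) as [H|H].
    - rewrite (ind_true _ H). destruct (Rle_lt_dec (INR n) Z) as [H'|H'].
      + rewrite (ind_true _ H').
        assert (H0 := ind_bounds (Z < INR n /\ (M < nfloor (x / INR n))%nat)). lra.
      + rewrite (ind_true (Z < INR n /\ _)) by (split; assumption).
        assert (H0 := ind_bounds (INR n <= Z)). lra.
    - rewrite (ind_false _ H). assert (H0 := ind_bounds (INR n <= Z)).
      assert (H0' := ind_bounds (Z < INR n /\ (M < nfloor (x / INR n))%nat)). lra. }
  rewrite ES. replace (Cminus (Cplus A1 A2) (Cmult Cf (RtoC x))) with
    (Cplus (Cplus (Cminus A1 (Cmult (csum v M) (RtoC x))) (Cmult (Cminus (csum v M) Cf) (RtoC x))) A2) by ring.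
  eapply Rle_trans; [apply Cmod_triangle|].
  eapply Rle_trans; [apply Rplus_le_compat_r, Cmod_triangle|].
  assert (HP := Rpower_pos (2 ^ r) beta). assert (0 <= C0 * Rpower (2 ^ r) beta) by nra.
  nra.
Qed.
End Assembly.

Theorem theorem2 :
  forall (r : nat) (h : nat -> C) (alpha k l : R),
    (2 <= r)%nat ->
    0 <= alpha <= 1 / (2 * INR r - 1) ->
    (exists C0 : R, forall d : nat, (1 <= d)%nat -> Cmod (h d) <= C0 * Rpower (INR d) alpha) ->
    exponent_pair k l ->
    l = INR r * k ->
    exists Cf : C,
      is_series (fun n : nat => Cdiv (f_of r h (S n)) (RtoC (INR (S n) * INR (S (S n))))) Cf /\
      exists C : R, forall x : R, 2 <= x ->
        Cmod (Cminus (S_sum (f_of r h) x) (Cmult Cf (RtoC x)))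
          <= C * (Rpower x (alpha / (INR r + 1) + k / (k + 1))
                    * (if Req_EM_T alpha 0 then ln x else 1)
                  + Rpower x ((1 + alpha) / (2 * INR r))).
Proof.
  intros r h alpha k l Hr Halpha [C0 HC0] Hkl Hlk.
  assert (Hr2 : 2 <= INR r) by now apply (le_INR 2).
  apply (floor_sum_asymptotics r h alpha k l (Rabs C0)); try assumption.
  (* For r >= 2, 1/(2r-1) <= 1/3, the form in which both sections take the hypothesis. *)
  - split; [lra|]. apply Rle_trans with (1 / (2 * INR r - 1)); [lra|].
    apply Rmult_le_compat_l; [lra|]. apply Rinv_le_contravar; lra.
  - apply Rabs_pos.
  - intros d Hd. eapply Rle_trans; [now apply HC0|].
    apply Rmult_le_compat_r; [apply Rlt_le, Rpower_pos|apply Rle_abs].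
Qed.
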